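(* Let $G$ be a normed group and $X$ a metric space, and suppose (i) $G$ has a separately continuous and transitive Nikodym action $\varphi$ on $X$, and (ii) $G$ is a Baire space under its norm topology and $X$ is non-meagre (in itself). Then for every open neighbourhood $U$ of $e_G$ and every $x\in X$, the set $Ux=\{u(x):u\in U\}$ is a neighbourhood of $x$; in particular each point-evaluation map $\varphi_x:g\mapsto g(x)$ is open, i.e. the action is micro-transitive. Moreover, the same conclusion holds if, in place of the Nikodym property of the action, one assumes that $G$ is analytic and Baire and all point-evaluation maps $\varphi_x$ are base-$\sigma$-discrete.
   Context: All spaces are metrizable. A normed group is a group $G$ with a group-norm $\|\cdot\|:G\to\mathbb R_+$ satisfying $\|st\|\le\|s\|+\|t\|$, $\|t\|>0$ for $t\ne e_G$, $\|e_G\|=0$, and $\|t^{-1}\|=\|t\|$; its (right) norm topology is that of the right-invariant metric $d_R(s,t)=\|st^{-1}\|$. A group action $\varphi:G\times X\to X$ satisfies $\varphi(e_G,x)=x$, $\varphi(gh,x)=\varphi(g,\varphi(h,x))$; write $g(x)=gx=\varphi(g,x)$. It is separately continuous if $x\mapsto\varphi(g,x)$ is continuous for each $g$ and $\varphi_x:g\mapsto\varphi(g,x)$ is continuous for each $x$; transitive if for all $x,y$ there is $g$ with $g(x)=y$. The action is a Nikodym action if for every non-empty open neighbourhood $U$ of $e_G$ and every $x\in X$, $Ux$ contains a non-meagre set with the Baire property. The action is micro-transitive if $Ax$ is a neighbourhood of $x$ for every $x$ and every neighbourhood $A$ of $e_G$. A metrizable space is analytic if it embeds in its metric completion as a Souslin-$\mathcal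 F$ set $\bigcup_{i\in\mathbb N^{\mathbb N}}\bigcap_n H(i|n)$ with $H(i|n)$ closed. A family is discrete if every point has a neighbourhood meeting at most one member; $\sigma$-discrete if a countable union of discrete families; $\mathcal B$ is a base for $\mathcal A$ if every member of $\mathcal A$ is a union of members of $\mathcal B$. A map $f:X\to Y$ is base-$\sigma$-discrete if the image $\{f(E):E\in\mathcal E\}$ of any discrete family $\mathcal E$ in $X$ has a $\sigma$-discrete base in $Y$. *)

(* Defs.v *)
From Stdlib Require Import Reals List.
Open Scope R_scope.
Set Implicit Arguments.

Definition is_metric {X : Type} (d : X -> X -> R) : Prop :=
  (forall x y, 0 <= d x y) /\
  (forall x y, d x y = 0 <-> x = y) /\
  (forall x y, d x y = d y x) /\
  (forall x y z, d x z <= d x y + d y z).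

Definition mopen {X : Type} (d : X -> X -> R) (A : X -> Prop) : Prop :=
  forall x, A x -> exists eps, 0 < eps /\ forall y, d x y < eps -> A y.

Definition mclosed {X : Type} (d : X -> X -> R) (A : X -> Prop) : Prop :=
  mopen d (fun x => ~ A x).

Definition mnbhs {X : Type} (d : X -> X -> R) (x : X) (N : X -> Prop) : Prop :=
  exists U, mopen d U /\ U x /\ (forall y, U y -> N y).

Definition mclosure {X : Type} (d : X -> X -> R) (A : X -> Prop) (x : X) : Prop :=
  forall eps, 0 < eps -> exists y, A y /\ d x y < eps.

Definition nowhere_dense {X : Type} (d : X -> X -> R) (A : X -> Prop) : Prop :=
  forall U, mopen d U -> (forall y, U y -> mclosure d A y) -> forall y, ~ U y.

Definition meagre {X : Type} (d : X -> X -> R) (A : X -> Prop) : Prop :=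
  exists N : nat -> X -> Prop,
    (forall n, nowhere_dense d (N n)) /\
    (forall x, A x -> exists n, N n x).

Definition baire_property {X : Type} (d : X -> X -> R) (A : X -> Prop) : Prop :=
  exists U, mopen d U /\ meagre d (fun x => (A x /\ ~ U x) \/ (U x /\ ~ A x)).

Definition baire_space {X : Type} (d : X -> X -> R) : Prop :=
  forall U, mopen d U -> (exists x, U x) -> ~ meagre d U.

Definition mcontinuous {X Y : Type} (dX : X -> X -> R) (dY : Y -> Y -> R)
  (f : X -> Y) : Prop :=
  forall a eps, 0 < eps -> exists delta, 0 < delta /\
    forall b, dX a b < delta -> dY (f a) (f b) < eps.

Definition open_map {X Y : Type} (dX : X -> X -> R) (dY : Y -> Y -> R)
  (f : X -> Y) : Prop :=
  forall A, mopen dX A -> mopen dY (fun y => exists a, A a /\ f a = y).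

Definition mcomplete {X : Type} (d : X -> X -> R) : Prop :=
  forall u : nat -> X,
    (forall eps, 0 < eps -> exists N, forall m n, (N <= m)%nat -> (N <= n)%nat ->
        d (u m) (u n) < eps) ->
    exists l, forall eps, 0 < eps -> exists N, forall n, (N <= n)%nat -> d (u n) l < eps.

Definition family (X : Type) := (X -> Prop) -> Prop.

Definition discrete_family {X : Type} (d : X -> X -> R) (F : family X) : Prop :=
  forall x, exists N, mnbhs d x N /\
    forall A1 A2, F A1 -> F A2 ->
      (exists y, N y /\ A1 y) -> (exists y, N y /\ A2 y) -> A1 = A2.

Definition sigma_discrete {X : Type} (d : X -> X -> R) (F : family X) : Prop :=
  exists Fn : nat -> family X,
    (forall n, discrete_family d (Fn n)) /\
    (forall A, F A <-> exists n, Fn n A).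

Definition base_for {X : Type} (B A : family X) : Prop :=
  forall S, A S -> exists C : family X, (forall c, C c -> B c) /\
    (forall y, S y <-> exists c, C c /\ c y).

Definition base_sigma_discrete {X Y : Type} (dX : X -> X -> R) (dY : Y -> Y -> R)
  (f : X -> Y) : Prop :=
  forall E : family X, discrete_family dX E ->
    exists B : family Y, sigma_discrete dY B /\
      base_for B (fun S => exists E0, E E0 /\ S = (fun y => exists a, E0 a /\ f a = y)).

Definition restr (i : nat -> nat) (n : nat) : list nat := map i (seq 0 n).

Definition souslinF {Y : Type} (d : Y -> Y -> R) (S : Y -> Prop) : Prop :=
  exists H : list nat -> Y -> Prop,
    (forall s, mclosed d (H s)) /\
    (forall y, S y <-> exists i : nat -> nat, forall n, H (restr i n) y).

(* (X,d) is analytic: it sits isometrically in a complete metric space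
   (equivalently, in its metric completion) as a Souslin-F set. *)
Definition analytic {X : Type} (d : X -> X -> R) : Prop :=
  exists (Y : Type) (dY : Y -> Y -> R) (j : X -> Y),
    is_metric dY /\ mcomplete dY /\
    (forall a b, dY (j a) (j b) = d a b) /\
    souslinF dY (fun y => exists a, j a = y).

Definition is_group {G : Type} (mul : G -> G -> G) (inv : G -> G) (e : G) : Prop :=
  (forall a b c, mul a (mul b c) = mul (mul a b) c) /\
  (forall a, mul e a = a) /\ (forall a, mul a e = a) /\
  (forall a, mul (inv a) a = e) /\ (forall a, mul a (inv a) = e).

Definition is_group_norm {G : Type} (mul : G -> G -> G) (inv : G -> G) (e : G)
  (nrm : G -> R) : Prop :=
  (forall a, 0 <= nrm a) /\
  (forall s t, nrm (mul s t) <= nrm s + nrm t) /\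
  (forall t, t <> e -> 0 < nrm t) /\
  nrm e = 0 /\
  (forall t, nrm (inv t) = nrm t).

Definition dR {G : Type} (mul : G -> G -> G) (inv : G -> G) (nrm : G -> R) :
  G -> G -> R := fun s t => nrm (mul s (inv t)).

Definition is_action {G X : Type} (mul : G -> G -> G) (e : G)
  (phi : G -> X -> X) : Prop :=
  (forall x, phi e x = x) /\ (forall g h x, phi (mul g h) x = phi g (phi h x)).

Definition sep_continuous {G X : Type} (dG : G -> G -> R) (dX : X -> X -> R)
  (phi : G -> X -> X) : Prop :=
  (forall g, mcontinuous dX dX (phi g)) /\
  (forall x, mcontinuous dG dX (fun g => phi g x)).

Definition transitive_action {G X : Type} (phi : G -> X -> X) : Prop :=
  forall x y, exists g, phi g x = y.

Definition orbit_set {G X : Type} (phi : G -> X -> X) (U : G -> Prop) (x : X) :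
  X -> Prop := fun y => exists u, U u /\ phi u x = y.

Definition nikodym_action {G X : Type} (dG : G -> G -> R) (dX : X -> X -> R)
  (e : G) (phi : G -> X -> X) : Prop :=
  forall U, mopen dG U -> U e -> forall x,
    exists B, (forall y, B y -> orbit_set phi U x y) /\
      ~ meagre dX B /\ baire_property dX B.

Definition micro_transitive {G X : Type} (dG : G -> G -> R) (dX : X -> X -> R)
  (e : G) (phi : G -> X -> X) : Prop :=
  forall x A, mnbhs dG e A -> mnbhs dX x (orbit_set phi A x).

Definition conclusionE {G X : Type} (dG : G -> G -> R) (dX : X -> X -> R)
  (e : G) (phi : G -> X -> X) : Prop :=
  (forall U, mopen dG U -> U e -> forall x, mnbhs dX x (orbit_set phi U x)) /\
  (forall x, open_map dG dX (fun g => phi g x)) /\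
  micro_transitive dG dX e phi.

(* Main.v *)
(* Let B_s be the s-ball at e. Under the Nikodym hypothesis, translating B_s x by one of its
   elements shows that B_{2s} x is comeagre in a neighbourhood W_x of x; for y in W_x the sets
   B_{2s} x and B_{2s} y then meet, so y lies in B_{4s} x.

   In the analytic case it suffices that every B_s x is non-meagre: for y near x the images
   of B_s under g |-> gx and g |-> gy are both nowhere meagre in a common open set, and
   refining them alternately along a Souslin scheme of G yields p x = q y in the limit.
   Since G is Baire, B_s x can only be meagre if some B_r x0 lies in a closed nowhere dense
   set K. In the right norm topology left translations and inversion may be discontinuous,
   so this cannot be refuted by translating. Instead, take a countable subgroup Gamma such
   that Gamma x0 witnesses the nowhere density of K, and let XN be the closure of Gamma x0.
   A generic limit xi of elements of Gamma satisfies xi XN = XN, because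
   xi gamma^{-1} y -> y along gamma -> xi and xi is a homeomorphism of X. Base-sigma-
   discreteness implies that the inverses of such xi meet only countably many cells of a
   sigma-discrete cover of G by sets of diameter < r; fix an element m preserving XN in each.
   A generic xi also has xi x0 outside all the sets m^{-1} K, which are nowhere dense in XN.
   But some m is r-close to xi^{-1}, that is, m xi is in B_r, so m xi x0 is in K. *)

From Stdlib Require Import Reals Lra Lia List Classical ClassicalEpsilon
  FunctionalExtensionality PropExtensionality.
From Stdlib Require Cantor.
From mathcomp Require boolp wochoice.
Require Import Defs.

Set Bullet Behavior "Strict Subproofs".

(** * Extensionality, dependent choice and a null sequence of radii *)

Lemma set_ext {T : Type} (A B : T -> Prop) : (forall x, A x <-> B x) -> A = B.
Proof.
  intros H; apply functional_extensionality; intros x.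
  apply propositional_extensionality, H.
Qed.

Lemma dependent_choice {T : Type} (P : nat -> T -> Prop) (R : nat -> T -> T -> Prop) (x0 : T) :
  P 0%nat x0 ->
  (forall n x, P n x -> exists y, P (S n) y /\ R n x y) ->
  exists u : nat -> T, u 0%nat = x0 /\ forall n, P n (u n) /\ R n (u n) (u (S n)).
Proof.
  intros H0 Hstep.
  pose (next n x := epsilon (inhabits x) (fun y => P (S n) y /\ R n x y)).
  assert (Hnext : forall n x, P n x -> P (S n) (next n x) /\ R n x (next n x)).
  { intros n x Hx. exact (epsilon_spec (inhabits x) _ (Hstep n x Hx)). }
  pose (u := fix u n := match n with O => x0 | S k => next k (u k) end).
  assert (HP : forall n, P n (u n)).
  { induction n as [|n IH]; [exact H0|]. exact (proj1 (Hnext n _ IH)). }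
  exists u; split; [reflexivity|]. intros n; split; [apply HP|].
  exact (proj2 (Hnext n _ (HP n))).
Qed.

Definition rad (n : nat) : R := / (INR n + 1).

Lemma rad_pos n : 0 < rad n.
Proof. apply Rinv_0_lt_compat. pose proof (pos_INR n); lra. Qed.

Lemma rad_small eps : 0 < eps -> exists n, rad n < eps.
Proof.
  intros He. destruct (INR_unbounded (/ eps)) as [n Hn]. exists n. unfold rad.
  rewrite <- (Rinv_inv eps). apply Rinv_lt_contravar; [|lra].
  pose proof (Rinv_0_lt_compat _ He). apply Rmult_lt_0_compat; lra.
Qed.

Lemma rad_decr n m : (n <= m)%nat -> rad m <= rad n.
Proof.
  intros H. apply Rinv_le_contravar; [pose proof (pos_INR n); lra|].
  apply le_INR in H; lra.
Qed.

(** * Countable sets *)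

Definition countable {T : Type} (S : T -> Prop) : Prop :=
  exists u : nat -> T -> Prop,
    (forall n x y, u n x -> u n y -> x = y) /\ (forall x, S x -> exists n, u n x).

Lemma countable_sub {T : Type} (A B : T -> Prop) :
  countable B -> (forall x, A x -> B x) -> countable A.
Proof. intros [u [H1 H2]] HAB. exists u; auto. Qed.

Lemma countable_bind {S T : Type} (A : S -> Prop) (B : T -> Prop) (R : S -> T -> Prop) :
  countable A -> (forall s, A s -> countable (R s)) ->
  (forall t, B t -> exists s, A s /\ R s t) -> countable B.
Proof.
  intros [u [Hu1 Hu2]] HR HB.
  destruct (choice (fun (s : S) (v : nat -> T -> Prop) =>
    (forall n x y, v n x -> v n y -> x = y) /\ (A s -> forall t, R s t -> exists n, v n t)))
    as [v Hv].
  { intros s. destruct (classic (A s)) as [Hs|Hs].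
    - destruct (HR s Hs) as [w [Hw1 Hw2]]. exists w; auto.
    - exists (fun _ _ => False); split; tauto. }
  exists (fun k t => exists s, u (fst (Cantor.of_nat k)) s /\ v s (snd (Cantor.of_nat k)) t).
  split.
  - intros k x y [s [Hs Hx]] [s' [Hs' Hy]].
    rewrite (Hu1 _ _ _ Hs' Hs) in Hy. exact (proj1 (Hv s) _ _ _ Hx Hy).
  - intros t Ht. destruct (HB t Ht) as [s [Hs Hst]].
    destruct (Hu2 s Hs) as [n Hn]. destruct (proj2 (Hv s) Hs t Hst) as [m Hm].
    exists (Cantor.to_nat (n, m)). rewrite Cantor.cancel_of_to. exists s; auto.
Qed.

Lemma countable_nat (A : nat -> Prop) : countable A.
Proof. exists (fun n k => k = n). split; [intros; congruence|eauto]. Qed.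

Lemma countable_single {T : Type} (A : T -> Prop) :
  (forall x y, A x -> A y -> x = y) -> countable A.
Proof. intros H. exists (fun _ => A). split; [eauto|]. intros x Hx; exists 0%nat; auto. Qed.

Lemma countable_iUnion {T : Type} (A : nat -> T -> Prop) :
  (forall n, countable (A n)) -> countable (fun x => exists n, A n x).
Proof.
  intros H. apply (countable_bind (fun n : nat => True) _ A (countable_nat _)); auto.
  intros t [n Hn]; exists n; auto.
Qed.

Lemma countable_image {S T : Type} (A : S -> Prop) (f : S -> T) :
  countable A -> countable (fun y => exists x, A x /\ f x = y).
Proof.
  intros HA. apply (countable_bind A _ (fun s t => f s = t)); auto.
  intros s _. apply countable_single. intros; congruence.
Qed.

Lemma countable_inj {S T : Type} (A : S -> Prop) (B : T -> Prop) (f : S -> T) :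
  countable B -> (forall x, A x -> B (f x)) ->
  (forall x y, A x -> A y -> f x = f y -> x = y) -> countable A.
Proof.
  intros HB HAB Hf. apply (countable_bind B _ (fun t s => A s /\ f s = t)); auto.
  - intros t _. apply countable_single. intros x y [Hx <-] [Hy E]. symmetry; auto.
  - intros s Hs. exists (f s); auto.
Qed.

(** * Well-orders *)

(** In the boolean well-order every inhabited set has a unique minimum: uniqueness on pairs gives
    antisymmetry, existence on the inaccessible points gives well-foundedness. *)
Lemma well_order_exists (T : Type) : exists lt : T -> T -> Prop,
  well_founded lt /\ (forall x y, lt x y \/ x = y \/ lt y x).
Proof.
  destruct (wochoice.well_ordering_principle
    (eqtype.Equality.Pack (eqtype.Equality.Class (boolp.gen_eqMixin T)))) as [r Hr].
  assert (Hmin : forall A : T -> Prop, (exists x, A x) ->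
    exists z, A z /\ forall y, A y -> r z y = true).
  { intros A HA. destruct (Hr (fun x => boolp.asbool (A x))) as [z [[Hz1 Hz2] _]].
    - destruct HA as [x Hx]. exists x. apply (boolp.asboolT Hx).
    - exists z. split; [exact (boolp.asboolW Hz1)|].
      intros y Hy. apply Hz2. exact (boolp.asboolT Hy). }
  assert (Hanti : forall x y : T, r x y = true -> r y x = true -> x = y).
  { intros x y Hxy Hyx.
    destruct (Hr (fun z => boolp.asbool (z = x \/ z = y))) as [z [_ Hz]].
    { exists x. apply boolp.asboolT; auto. }
    assert (Hrefl : forall w, r w w = true).
    { intros w. destruct (Hmin (fun v => v = w)) as [v [-> Hv]]; eauto. }
    transitivity z; [symmetry|]; apply Hz; (split; [apply boolp.asboolT; auto|]);
      intros w Hw; apply boolp.asboolW in Hw; destruct Hw as [-> | ->]; auto; apply Hrefl. }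
  exists (fun x y => r x y = true /\ x <> y). split.
  - intros x. apply NNPP. intros Hx.
    destruct (Hmin (fun z => ~ Acc (fun x y => r x y = true /\ x <> y) z)) as [z [Hz1 Hz2]];
      [eauto|].
    apply Hz1. constructor. intros y [Hyz Hne]. apply NNPP. intros Hy.
    apply Hne, Hanti; auto.
  - intros x y. destruct (classic (x = y)); auto.
    destruct (Hmin (fun z => z = x \/ z = y)) as [z [[-> | ->] Hz]]; [exists x; auto| |].
    + left. auto.
    + right; right. split; [apply Hz; auto|congruence].
Qed.

Lemma wf_minimum {T : Type} (lt : T -> T -> Prop) (A : T -> Prop) :
  well_founded lt -> (exists x, A x) -> exists z, A z /\ forall y, lt y z -> ~ A y.
Proof.
  intros Hwf [x Hx]. apply NNPP. intros Hno.
  revert Hx. induction x as [x IH] using (well_founded_ind Hwf). intros Hx.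
  apply Hno. exists x. split; [exact Hx|]. intros y Hy Hy'. exact (IH y Hy Hy').
Qed.

Lemma uncountable_matching {S T : Type} (A : S -> Prop) (B : T -> Prop) :
  ~ countable A -> ~ countable B ->
  exists f : S -> T, (forall x, B (f x)) /\ ~ countable (fun y => exists x, A x /\ f x = y).
Proof.
  intros HA HB. destruct (well_order_exists S) as [lt [Hwf Htri]].
  assert (Hb : exists b, B b).
  { apply NNPP. intros H. apply HB. apply countable_single. intros x y Hx. exfalso; eauto. }
  destruct Hb as [b0 Hb0].
  (* [F x] avoids all the values taken at the points of [A] below [x], if it can *)
  pose (step x (g : forall y, lt y x -> T) := epsilon (inhabits b0)
    (fun b => B b /\ ((exists b', B b' /\ forall y (h : lt y x), A y -> g y h <> b') ->
                       forall y (h : lt y x), A y -> g y h <> b))).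
  pose (F := Fix Hwf (fun _ => T) step).
  assert (HF : forall x, B (F x) /\ ((exists b', B b' /\ forall y, lt y x -> A y -> F y <> b') ->
                       forall y, lt y x -> A y -> F y <> F x)).
  { intros x. assert (E : F x = step x (fun y _ => F y)).
    { unfold F. rewrite Fix_eq; [reflexivity|].
      intros z g h Hgh. f_equal. apply functional_extensionality_dep. intros y.
      apply functional_extensionality_dep. intros l. apply Hgh. }
    rewrite E. unfold step. apply epsilon_spec.
    destruct (classic (exists b', B b' /\ forall y, lt y x -> A y -> F y <> b'))
      as [[b' [H1 H2]]|H].
    - exists b'; split; auto.
    - exists b0; split; [auto|]. intros [b' [H1 H2]]. exfalso; eauto. }
  exists F. split; [intros x; apply HF|]. intros Hc.
  assert (Hfresh : exists b', B b' /\ forall y, A y -> F y <> b').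
  { apply NNPP. intros H. apply HB. apply (countable_sub _ _ Hc).
    intros b Hb. apply NNPP. intros Hb'. apply H. exists b; split; auto.
    intros y Hy E. apply Hb'; eauto. }
  destruct Hfresh as [b' [Hb1 Hb2]].
  apply HA. apply (countable_inj _ _ F Hc); [eauto|].
  assert (Hne : forall x y, lt y x -> A y -> F y <> F x).
  { intros x y Hlt Hy. apply (proj2 (HF x)); auto. exists b'; auto. }
  intros x y Hx Hy E. destruct (Htri x y) as [H|[H|H]]; auto; exfalso.
  - exact (Hne _ _ H Hx E).
  - exact (Hne _ _ H Hy (eq_sym E)).
Qed.

(** * Category in metric spaces *)

Definition ball {X : Type} (d : X -> X -> R) (x : X) (r : R) : X -> Prop := fun y => d x y < r.

Definition img {X Y : Type} (f : X -> Y) (P : X -> Prop) : Y -> Prop :=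
  fun y => exists a, P a /\ f a = y.

Section Metric.
Context {X : Type} (d : X -> X -> R) (Hd : is_metric d).

Lemma dist_nonneg x y : 0 <= d x y.
Proof. apply Hd. Qed.
Lemma dist_refl x : d x x = 0.
Proof. apply Hd; reflexivity. Qed.
Lemma dist_sym x y : d x y = d y x.
Proof. apply Hd. Qed.
Lemma dist_tri x y z : d x z <= d x y + d y z.
Proof. apply Hd. Qed.
Lemma dist_pos x y : x <> y -> 0 < d x y.
Proof.
  intros H. destruct (dist_nonneg x y) as [|E]; auto.
  exfalso; apply H, Hd; auto.
Qed.

Lemma ball_open x r : mopen d (ball d x r).
Proof.
  intros y Hy. exists (r - d x y). unfold ball in *. split; [lra|].
  intros z Hz. pose proof (dist_tri x y z). lra.
Qed.

Lemma ball_center x r : 0 < r -> ball d x r x.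
Proof. intros; unfold ball. rewrite dist_refl; auto. Qed.

Lemma open_inter (A B : X -> Prop) : mopen d A -> mopen d B -> mopen d (fun x => A x /\ B x).
Proof.
  intros HA HB x [Ha Hb]. destruct (HA x Ha) as [e1 [He1 H1]].
  destruct (HB x Hb) as [e2 [He2 H2]]. exists (Rmin e1 e2). split; [apply Rmin_glb_lt; auto|].
  intros y Hy. split; [apply H1|apply H2]; eapply Rlt_le_trans; eauto; [apply Rmin_l|apply Rmin_r].
Qed.

Lemma not_nowhere_dense (A : X -> Prop) : ~ nowhere_dense d A ->
  exists U, mopen d U /\ (exists y, U y) /\ forall y, U y -> mclosure d A y.
Proof.
  intros H. apply NNPP. intros H'. apply H. intros U HU Hcl y Hy. apply H'. eauto 6.
Qed.

Lemma meagre_sub (A B : X -> Prop) :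
  meagre d B -> (forall x, A x -> B x) -> meagre d A.
Proof. intros [N [H1 H2]] H. exists N; auto. Qed.

Lemma meagre_nowhere_dense (A : X -> Prop) : nowhere_dense d A -> meagre d A.
Proof. intros H. exists (fun _ => A); split; auto. intros x Hx; exists 0%nat; auto. Qed.

Lemma meagre_iUnion (A : nat -> X -> Prop) :
  (forall n, meagre d (A n)) -> meagre d (fun x => exists n, A n x).
Proof.
  intros H. destruct (choice _ H) as [N HN].
  exists (fun k => N (fst (Cantor.of_nat k)) (snd (Cantor.of_nat k))). split.
  - intros k. apply HN.
  - intros x [n Hx]. destruct (proj2 (HN n) x Hx) as [m Hm].
    exists (Cantor.to_nat (n, m)). rewrite Cantor.cancel_of_to. exact Hm.
Qed.

Lemma meagre_empty (A : X -> Prop) : (forall x, ~ A x) -> meagre d A.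
Proof.
  intros H. apply meagre_nowhere_dense. intros U _ Hcl y Hy.
  destruct (Hcl y Hy 1 Rlt_0_1) as [z [Hz _]]. exact (H z Hz).
Qed.

Lemma nonmeagre_inhabited (A : X -> Prop) : ~ meagre d A -> exists x, A x.
Proof. intros H. apply NNPP. intros H'. apply H, meagre_empty. eauto. Qed.

Lemma meagre_union (A B : X -> Prop) :
  meagre d A -> meagre d B -> meagre d (fun x => A x \/ B x).
Proof.
  intros HA HB. apply (meagre_sub _ (fun x => exists n, match n with O => A | _ => B end x)).
  - apply meagre_iUnion. intros [|n]; auto.
  - intros x [H|H]; [exists 0%nat|exists 1%nat]; auto.
Qed.

(** Nowhere density is local, and near a point at most one member is visible; so the [n]-th nowhere
    dense pieces of all members have a nowhere dense union. *)
Lemma meagre_discrete_union (F : family X) :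
  discrete_family d F -> (forall A, F A -> meagre d A) -> meagre d (fun x => exists A, F A /\ A x).
Proof.
  intros HF Hm.
  destruct (choice (fun (A : X -> Prop) (N : nat -> X -> Prop) => F A ->
    (forall n, nowhere_dense d (N n)) /\ (forall x, A x -> exists n, N n x))) as [N HN].
  { intros A. destruct (classic (F A)) as [HA|HA].
    - destruct (Hm A HA) as [N HN]; eauto.
    - exists (fun _ _ => False); tauto. }
  exists (fun n x => exists A, F A /\ A x /\ N A n x). split.
  - intros n U HU Hcl y Hy. destruct (HF y) as [V' [[V [HV [HVy HVV']]] Hdisc]].
    destruct (Hcl y Hy 1 Rlt_0_1) as [z0 [[A0 _] _]].
    assert (HA : exists A, F A /\ forall z B, V z -> F B -> B z -> B = A).
    { destruct (classic (exists A z, F A /\ V z /\ A z)) as [[A [z [HA [Hz1 Hz2]]]]|Hno].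
      - exists A; split; auto. intros w B Hw HB HBw. apply Hdisc; auto; eauto.
      - exfalso. destruct (HV y HVy) as [e [He HeV]].
        destruct (Hcl y Hy e He) as [z [[A [HA [HAz _]]] Hz]]. apply Hno. exists A, z; auto. }
    destruct HA as [A [HFA HA]].
    apply (proj1 (HN A HFA) n (fun z => U z /\ V z) (open_inter _ _ HU HV)) with (y := y); auto.
    intros w [HUw HVw] e He. destruct (HV w HVw) as [e' [He' HeV]].
    destruct (Hcl w HUw (Rmin e e')) as [z [[B [HFB [HBz HNz]]] Hz]]; [apply Rmin_glb_lt; auto|].
    assert (HB : B = A).
    { apply (HA z); auto. apply HeV. eapply Rlt_le_trans; eauto. apply Rmin_r. }
    subst B. exists z; split; auto. eapply Rlt_le_trans; eauto. apply Rmin_l.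
  - intros x [A [HA Hx]]. destruct (proj2 (HN A HA) x Hx) as [n Hn]. eauto 6.
Qed.

Lemma meagre_sigma_discrete_union (B : family X) :
  sigma_discrete d B -> (forall A, B A -> meagre d A) -> meagre d (fun x => exists A, B A /\ A x).
Proof.
  intros [Fn [HFn HB]] Hm.
  apply (meagre_sub _ (fun x => exists n, exists A, Fn n A /\ A x)).
  - apply meagre_iUnion. intros n. apply meagre_discrete_union; auto.
    intros A HA. apply Hm, HB; eauto.
  - intros x [A [HA Hx]]. apply HB in HA. destruct HA as [n HA]; eauto.
Qed.

(** A member meeting [S] at [y] is the only one of its discrete layer near [y], so a close point
    [q j] and a radius [rad l] determine it. *)
Lemma countable_trace (B : family X) (q : nat -> X) (S : X -> Prop) :
  sigma_discrete d B -> (forall x, S x -> mclosure d (fun y => exists n, y = q n) x) ->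
  countable (fun b => B b /\ exists y, b y /\ S y).
Proof.
  intros [Fn [HFn HB]] HS.
  apply (countable_sub _ (fun b => exists k, Fn k b /\ exists y, b y /\ S y)).
  2:{ intros b [Hb Hy]. apply HB in Hb. destruct Hb as [k Hk]; eauto. }
  apply countable_iUnion. intros k.
  exists (fun c b => Fn k b /\
    let r := rad (snd (Cantor.of_nat c)) in let x := q (fst (Cantor.of_nat c)) in
    (exists y, b y /\ ball d x r y) /\
    forall b' y, Fn k b' -> b' y -> ball d x r y -> b' = b).
  split.
  - intros n b b' [Hb [[y [Hy1 Hy2]] Hu]] [Hb' [[y' [Hy1' Hy2']] Hu']]. eapply Hu'; eauto.
  - intros b [Hb [y [Hby HSy]]]. destruct (HFn k y) as [V' [[V [HV [HVy HVV']]] Hdisc]].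
    destruct (HV y HVy) as [e [He HeV]]. destruct (rad_small (e / 2)) as [l Hl]; [lra|].
    destruct (HS y HSy (rad l) (rad_pos l)) as [x [[j ->] Hx]].
    exists (Cantor.to_nat (j, l)). rewrite Cantor.cancel_of_to. split; auto. simpl. split.
    + exists y; split; auto. unfold ball. rewrite dist_sym; auto.
    + intros b' y' Hb' Hy' Hball. apply Hdisc; auto.
      * exists y'; split; auto. apply HVV', HeV. unfold ball in Hball.
        pose proof (dist_tri y (q j) y'). lra.
      * exists y; auto.
Qed.

(** A uniform form of discreteness, inherited by subcells and, with a smaller constant, by small
    displacements. *)
Definition separated (rho : R) (C : X -> X -> Prop) : Prop :=
  forall g g' y y', C g y -> C g' y' -> g <> g' -> rho <= d y y'.

Lemma separated_discrete rho (C : X -> X -> Prop) :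
  0 < rho -> separated rho C -> discrete_family d (fun S => exists g, S = C g).
Proof.
  intros Hrho HC x. exists (ball d x (rho / 2)). split.
  - exists (ball d x (rho / 2)). split; [apply ball_open|]. split; [apply ball_center; lra|auto].
  - intros A1 A2 [g1 ->] [g2 ->] [y1 [Hy1 H1]] [y2 [Hy2 H2]].
    destruct (classic (g1 = g2)) as [->|Hne]; auto. exfalso.
    pose proof (HC _ _ _ _ H1 H2 Hne). unfold ball in *.
    pose proof (dist_tri y1 x y2). pose proof (dist_sym y1 x). lra.
Qed.

(* M. E. Rudin's argument: [g] is the first point within [eps] of [y], and the
   ball of radius [rad n] about [y] stays within [eps] of [g]. *)
Lemma stone_cover eps : 0 < eps -> exists E : nat -> X -> X -> Prop,
  (forall y, exists n g, E n g y) /\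
  (forall n g y, E n g y -> d g y < eps) /\
  (forall n, separated (rad n) (E n)).
Proof.
  intros He. destruct (well_order_exists X) as [lt [Hwf Htri]].
  exists (fun n g y => d g y < eps /\ (forall h, lt h g -> ~ d h y < eps) /\
             forall z, d y z < rad n -> d g z < eps).
  split; [|split].
  - intros y. destruct (wf_minimum lt (fun g => d g y < eps) Hwf) as [g [Hg Hmin]].
    { exists y. rewrite dist_refl; auto. }
    destruct (rad_small (eps - d g y)) as [n Hn]; [lra|].
    exists n, g. split; [exact Hg|]. split; [exact Hmin|].
    intros z Hz. pose proof (dist_tri g y z). lra.
  - intros n g y H; exact (proj1 H).
  - intros n g g' y y' [H1 [H2 H3]] [H1' [H2' H3']] Hne.
    apply Rnot_lt_le. intros Hlt. destruct (Htri g g') as [H|[H|H]]; auto.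
    + exact (H2' g H (H3 y' Hlt)).
    + rewrite dist_sym in Hlt. exact (H2 g' H (H3' y Hlt)).
Qed.

End Metric.

(** * Base-sigma-discrete maps *)

Section Maps.
Context {X Y : Type} (dX : X -> X -> R) (dY : Y -> Y -> R)
  (HX : is_metric dX) (HY : is_metric dY)
  (f : X -> Y) (Hf : base_sigma_discrete dX dY f).

Lemma cells_base rho (C : X -> X -> Prop) : 0 < rho -> separated dX rho C ->
  exists B, sigma_discrete dY B /\
    forall g y, img f (C g) y -> exists b, B b /\ b y /\ forall z, b z -> img f (C g) z.
Proof.
  intros Hrho HC. destruct (Hf _ (separated_discrete dX HX rho C Hrho HC)) as [B [HB Hbase]].
  exists B; split; auto. intros g y Hy.
  destruct (Hbase (img f (C g))) as [D [HD1 HD2]].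
  { exists (C g); split; [eauto|reflexivity]. }
  destruct (proj1 (HD2 y) Hy) as [b [Hb1 Hb2]].
  exists b; split; auto. split; auto. intros z Hz. apply HD2; eauto.
Qed.

(** The meagre members of the base still form a sigma-discrete family, and they suffice: a base
    member inside a meagre image is meagre. *)
Lemma meagre_image_cells rho (C : X -> X -> Prop) : 0 < rho -> separated dX rho C ->
  (forall g, meagre dY (img f (C g))) -> meagre dY (img f (fun a => exists g, C g a)).
Proof.
  intros Hrho HC Hm. destruct (cells_base rho C Hrho HC) as [B [[Fn [HFn HB]] Hbase]].
  apply (meagre_sub dY _ (fun y => exists b, (B b /\ meagre dY b) /\ b y)).
  - apply meagre_sigma_discrete_union; [|tauto].
    exists (fun n b => Fn n b /\ meagre dY b). split.
    + intros n x. destruct (HFn n x) as [N [HN Hd]]. exists N; split; auto.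
      intros A1 A2 [H1 _] [H2 _]; auto.
    + intros b. rewrite HB. firstorder.
  - intros y [a [[g Ha] <-]]. destruct (Hbase g (f a)) as [b [H1 [H2 H3]]].
    { exists a; auto. }
    exists b; repeat split; auto. apply (meagre_sub dY _ (img f (C g))); auto.
Qed.

(** Within a cell of diameter less than [eps], all of [P0] lies [eps]-close to any one of its
    points, so its image is meagre; the cells then add up. *)
Lemma meagre_image_locally_meagre (P : X -> Prop) eps : 0 < eps ->
  meagre dY (img f (fun a => P a /\ meagre dY (img f (fun a' => P a' /\ dX a a' < eps)))).
Proof.
  intros He. set (P0 := fun a => P a /\ _).
  destruct (stone_cover dX HX (eps / 2)) as [E [HE1 [HE2 HE3]]]; [lra|].
  apply (meagre_sub dY _ (fun y => exists n, img f (fun a => exists g, E n g a /\ P0 a) y)).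
  - apply meagre_iUnion. intros n.
    apply (meagre_image_cells (rad n) (fun g a => E n g a /\ P0 a) (rad_pos n)).
    + intros g g' y y' [H _] [H' _]. apply HE3; auto.
    + intros g. destruct (classic (exists a, E n g a /\ P0 a)) as [[a [Ha [HPa Hma]]]|H].
      * apply (meagre_sub dY _ _ Hma). intros y [a' [[Ha' [HPa' _]] <-]].
        exists a'; repeat split; auto.
        pose proof (HE2 _ _ _ Ha). pose proof (HE2 _ _ _ Ha').
        pose proof (dist_tri dX HX a g a'). pose proof (dist_sym dX HX a g). lra.
      * apply meagre_empty. intros y [a [Ha _]]; eauto.
  - intros y [a [Ha <-]]. destruct (HE1 a) as [n [g Hg]]. exists n, a; eauto.
Qed.

Lemma nonmeagre_image_local (P : X -> Prop) eps : 0 < eps -> ~ meagre dY (img f P) ->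
  exists a, P a /\ ~ meagre dY (img f (fun a' => P a' /\ dX a a' < eps)).
Proof.
  intros He HP. apply NNPP. intros H. apply HP.
  apply (meagre_sub dY _ _ (meagre_image_locally_meagre P eps He)).
  intros y [a [Ha <-]]. exists a; repeat split; auto. apply NNPP. intros Hm. eauto.
Qed.

Definition heavy_point (P : X -> Prop) (a : X) : Prop :=
  P a /\ forall n, ~ meagre dY (img f (fun a' => P a' /\ dX a a' < rad n)).

Lemma meagre_image_not_heavy (P : X -> Prop) :
  meagre dY (img f (fun a => P a /\ ~ heavy_point P a)).
Proof.
  apply (meagre_sub dY _ _ (meagre_iUnion dY _
    (fun n => meagre_image_locally_meagre P (rad n) (rad_pos n)))).
  intros y [a [[Ha Hn] <-]]. apply NNPP. intros H. apply Hn. split; auto.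
  intros n Hm. apply H. exists n, a; auto.
Qed.

End Maps.

Lemma base_sigma_discrete_id {X : Type} (d : X -> X -> R) : base_sigma_discrete d d (fun x => x).
Proof.
  intros E HE. exists E. split.
  - exists (fun _ => E). split; auto. intros A. split; [exists 0%nat; auto|intros [_ H]; auto].
  - intros S [E0 [HE0 ->]]. exists (fun c => c = E0). split; [intros c ->; auto|].
    intros y; split.
    + intros [a [Ha <-]]; eauto.
    + intros [c [-> Hy]]; eauto.
Qed.

(** Stands in for comeagreness in [O] where [S] need not have the Baire property. *)
Definition nonmeagre_throughout {X : Type} (d : X -> X -> R) (S O : X -> Prop) : Prop :=
  forall U, mopen d U -> (exists x, U x) -> (forall x, U x -> O x) ->
    ~ meagre d (fun x => S x /\ U x).

(* A form of the Banach category theorem. *)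
Lemma nonmeagre_throughout_somewhere {X : Type} (d : X -> X -> R) (S : X -> Prop) :
  is_metric d -> ~ meagre d S ->
  exists O, mopen d O /\ (exists x, O x) /\ nonmeagre_throughout d S O.
Proof.
  intros Hd HS.
  assert (H : ~ nowhere_dense d (heavy_point d d (fun x => x) S)).
  { intros H. apply HS. apply (meagre_sub d _ _ (meagre_union d _ _
      (meagre_nowhere_dense d _ H)
      (meagre_image_not_heavy d d Hd Hd (fun x => x) (base_sigma_discrete_id d) S))).
    intros x Hx. destruct (classic (heavy_point d d (fun x => x) S x)); auto.
    right. exists x; auto. }
  destruct (not_nowhere_dense d _ H) as [O [HO [Hne Hcl]]].
  exists O; split; auto. split; auto. intros U HU [x Hx] HUO Hm.
  destruct (HU x Hx) as [e [He HeU]].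
  destruct (Hcl x (HUO x Hx) e He) as [a [[Ha1 Ha2] Ha3]].
  destruct (HU a (HeU a Ha3)) as [e' [He' HeU']].
  destruct (rad_small e' He') as [n Hn]. apply (Ha2 n).
  apply (meagre_sub d _ _ Hm). intros y [a' [[H1 H2] <-]]. split; auto. apply HeU'. lra.
Qed.

Lemma nonmeagre_throughout_sub {X : Type} (d : X -> X -> R) (S S' O O' : X -> Prop) :
  nonmeagre_throughout d S O -> (forall x, S x -> S' x) -> (forall x, O' x -> O x) ->
  nonmeagre_throughout d S' O'.
Proof.
  intros H HS HO U HU Hne HUO Hm. apply (H U HU Hne); auto.
  apply (meagre_sub d _ _ Hm). intros x []; auto.
Qed.

(** * Souslin schemes *)

Section Scheme.
Context {G : Type} (d : G -> G -> R) (Hd : is_metric d).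

Definition halving (eps : nat -> R) : Prop :=
  (forall n, 0 < eps n) /\ forall n, eps (S n) <= eps n / 2.

(** The last clause takes the place of completeness: along a branch, steps bounded by a halving
    sequence lead to a limit in [G], with the geometric tail [2 * eps n] as error. *)
Definition souslin_scheme (A : list nat -> G -> Prop) : Prop :=
  (forall g, A nil g) /\
  (forall s g, A s g -> exists k, A (s ++ k :: nil) g) /\
  (forall (s : nat -> list nat) (u : nat -> G) (eps : nat -> R),
     s 0%nat = nil -> (forall n, exists k, s (S n) = s n ++ k :: nil) ->
     (forall n, A (s n) (u n)) -> halving eps -> (forall n, d (u n) (u (S n)) < eps n) ->
     exists l, forall n, d (u n) l <= 2 * eps n).

Lemma halving_small eps : halving eps -> forall e, 0 < e -> exists N, eps N < e.
Proof.
  intros [Hpos Hhalf] e He.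
  assert (H : forall n, eps n <= eps 0%nat * rad n).
  { induction n as [|n IH].
    - unfold rad; simpl. lra.
    - apply Rle_trans with (1 := Hhalf n).
      assert (rad n / 2 <= rad (S n)).
      { unfold rad. rewrite S_INR. pose proof (pos_INR n).
        unfold Rdiv. rewrite <- Rinv_mult. apply Rinv_le_contravar; lra. }
      pose proof (Hpos 0%nat).
      apply Rle_trans with (eps 0%nat * (rad n / 2)); [lra|].
      apply Rmult_le_compat_l; lra. }
  destruct (rad_small (e / eps 0%nat)) as [N HN].
  { apply Rdiv_lt_0_compat; auto. }
  exists N. apply Rle_lt_trans with (1 := H N).
  apply Rmult_lt_compat_l with (r := eps 0%nat) in HN; auto.
  replace (eps 0%nat * (e / eps 0%nat)) with e in HN; auto.
  field. pose proof (Hpos 0%nat); lra.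
Qed.

Lemma halving_decr eps : halving eps -> forall n m, (n <= m)%nat -> eps m <= eps n.
Proof.
  intros [Hpos Hhalf] n m H. induction H as [|m H IH]; [lra|].
  pose proof (Hhalf m). pose proof (Hpos m). lra.
Qed.

Lemma halving_dist (u : nat -> G) eps : halving eps -> (forall n, d (u n) (u (S n)) < eps n) ->
  forall n m, (n <= m)%nat -> d (u n) (u m) <= 2 * eps n - 2 * eps m.
Proof.
  intros [Hpos Hhalf] Hu n m H. induction H as [|m H IH].
  - rewrite dist_refl; auto; lra.
  - pose proof (dist_tri d Hd (u n) (u m) (u (S m))). pose proof (Hu m). pose proof (Hhalf m). lra.
Qed.

Lemma analytic_souslin_scheme : analytic d -> exists A, souslin_scheme A.
Proof.
  intros [Y [dY [j [HY [Hcomp [Hiso [H [Hcl HS]]]]]]]].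
  assert (restr_S : forall i n, restr i (S n) = restr i n ++ i n :: nil).
  { intros i n. unfold restr. rewrite seq_S, map_app. reflexivity. }
  exists (fun s g => exists i, restr i (length s) = s /\ forall n, H (restr i n) (j g)).
  split; [|split].
  - intros g. destruct (proj1 (HS (j g))) as [i Hi]; eauto.
  - intros s g [i [Hs Hi]]. exists (i (length s)), i. split; auto.
    rewrite length_app; simpl. rewrite Nat.add_1_r, restr_S, Hs. reflexivity.
  - intros s u eps Hs0 HsS HA Heps Hu.
    destruct (choice _ HsS) as [i Hi].
    assert (Hsi : forall n, s n = restr i n).
    { induction n as [|n IH]; [exact Hs0|]. rewrite restr_S, <- IH. apply Hi. }
    assert (restr_prefix : forall i' n m, (n <= m)%nat -> restr i' m = restr i m ->
      restr i' n = restr i n).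
    { intros i' n m Hnm. induction Hnm as [|m Hnm IH]; auto.
      rewrite !restr_S. intros E. apply IH. apply app_inj_tail in E. tauto. }
    destruct (Hcomp (fun n => j (u n))) as [l Hl].
    { intros e He. destruct (halving_small eps Heps (e / 2)) as [N HN]; [lra|].
      assert (Hord : forall m n, (N <= m)%nat -> (m <= n)%nat -> d (u m) (u n) < e).
      { intros m n Hm Hn. pose proof (halving_dist u eps Heps Hu m n Hn).
        pose proof (halving_decr eps Heps N m Hm). pose proof (proj1 Heps n). lra. }
      exists N. intros m n Hm Hn. rewrite Hiso.
      destruct (Nat.le_ge_cases m n); [auto|rewrite dist_sym; auto]. }
    (* Later points of the sequence lie in the closed set [H (restr i n)], hence so does [l], which
       therefore comes from [G]. *)
    assert (Hln : forall n, H (restr i n) l).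
    { intros n. apply NNPP. intros Hno. destruct (Hcl _ _ Hno) as [e [He Hfar]].
      destruct (Hl e He) as [N HN].
      apply (Hfar (j (u (max N n)))).
      - rewrite dist_sym; auto. apply HN. lia.
      - destruct (HA (max N n)) as [i' [Hi'1 Hi'2]].
        rewrite Hsi in Hi'1. unfold restr in Hi'1 at 2 3. rewrite length_map, length_seq in Hi'1.
        rewrite <- (restr_prefix i' n (max N n)); auto. lia. }
    destruct (proj2 (HS l) (ex_intro _ i Hln)) as [p <-].
    exists p. intros n. apply Rnot_lt_le. intros Hlt.
    destruct (Hl (d (u n) p - 2 * eps n)) as [N HN]; [lra|].
    pose proof (HN (max N n) (Nat.le_max_l _ _)) as H1. rewrite Hiso in H1.
    pose proof (halving_dist u eps Heps Hu n (max N n) (Nat.le_max_r _ _)).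
    pose proof (dist_tri d Hd (u n) (u (max N n)) p). pose proof (proj1 Heps (max N n)). lra.
Qed.

Context {X : Type} (dX : X -> X -> R) (HX : is_metric dX)
  (A : list nat -> G -> Prop) (HA : souslin_scheme A).

(** Countably many children cover the piece, so one of them keeps a non-meagre image in [O];
    localizing gives [p'], and the Banach category theorem gives [O']. *)
Lemma refine_piece (f : G -> X) s p e O e' : base_sigma_discrete d dX f ->
  mopen dX O -> (exists x, O x) ->
  nonmeagre_throughout dX (img f (fun a => A s a /\ d p a < e)) O -> 0 < e' ->
  exists k p' O', A (s ++ k :: nil) p' /\ d p p' < e /\ O (f p') /\
    mopen dX O' /\ (exists x, O' x) /\ (forall x, O' x -> O x) /\
    nonmeagre_throughout dX (img f (fun a => A (s ++ k :: nil) a /\ d p' a < e')) O'.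
Proof.
  intros Hf HO Hne Hth He'.
  assert (H1 : exists k, ~ meagre dX
    (img f (fun a => (A (s ++ k :: nil) a /\ d p a < e) /\ O (f a)))).
  { apply NNPP. intros Hno. apply (Hth O HO Hne (fun x h => h)).
    apply (meagre_sub dX _ (fun x => exists k,
      img f (fun a => (A (s ++ k :: nil) a /\ d p a < e) /\ O (f a)) x)).
    - apply meagre_iUnion. intros k. apply NNPP. intros Hk. eauto.
    - intros x [[a [[Ha1 Ha2] <-]] Hx]. destruct (proj1 (proj2 HA) s a Ha1) as [k Hk].
      exists k, a; auto. }
  destruct H1 as [k Hk].
  destruct (nonmeagre_image_local d dX Hd HX f Hf _ e' He' Hk)
    as [p' [[[Hp1 Hp2] Hp3] Hm]].
  destruct (nonmeagre_throughout_somewhere dX _ HX Hm) as [O1 [HO1 [Hne1 Hth1]]].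
  exists k, p', (fun x => O1 x /\ O x). repeat split; auto.
  - apply open_inter; auto.
  - destruct (nonmeagre_inhabited dX _ (Hth1 O1 HO1 Hne1 (fun x h => h)))
      as [x [[a [[[_ Ha] _] <-]] Hx]]. eauto.
  - tauto.
  - apply (nonmeagre_throughout_sub _ _ _ _ _ Hth1).
    + intros x [a [[[[H1 _] _] H2] <-]]. exists a; auto.
    + tauto.
Qed.

(* Both images are refined alternately along the scheme inside common open sets
   [O] with diameters tending to 0; the two limits have the same value. *)
Lemma images_meet (f h : G -> X) a b eps O :
  mcontinuous d dX f -> mcontinuous d dX h ->
  base_sigma_discrete d dX f -> base_sigma_discrete d dX h -> 0 < eps ->
  mopen dX O -> (exists x, O x) ->
  nonmeagre_throughout dX (img f (ball d a eps)) O ->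
  nonmeagre_throughout dX (img h (ball d b eps)) O ->
  exists p q, d a p <= 2 * eps /\ d b q <= 2 * eps /\ f p = h q.
Proof.
  intros Hfc Hhc Hf Hh He HO Hne Htf Hth.
  pose (E := fun n => eps * (/ 2) ^ n).
  assert (HE : halving E).
  { split; intros n; unfold E; simpl; [|lra].
    apply Rmult_lt_0_compat; auto. apply pow_lt; lra. }
  destruct (dependent_choice (T := (G * list nat) * (G * list nat) * (X -> Prop))
    (fun n '((p, s), (q, t), W) =>
       A s p /\ A t q /\ mopen dX W /\ (exists x, W x) /\
       nonmeagre_throughout dX (img f (fun a => A s a /\ d p a < E n)) W /\
       nonmeagre_throughout dX (img h (fun a => A t a /\ d q a < E n)) W)
    (fun n '((p, s), (q, t), W) '((p', s'), (q', t'), W') =>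
       (exists k, s' = s ++ k :: nil) /\ (exists k, t' = t ++ k :: nil) /\
       d p p' < E n /\ d q q' < E n /\ W (f p') /\ W (h q') /\
       forall x y, W' x -> W' y -> dX x y < rad n)
    ((a, nil), (b, nil), O)) as [u [Hu0 Hu]].
  { destruct HA as [HA0 _]. unfold E; simpl. rewrite Rmult_1_r.
    repeat split; auto.
    - apply (nonmeagre_throughout_sub _ _ _ _ _ Htf); auto. intros x [c [Hc <-]]; exists c; auto.
    - apply (nonmeagre_throughout_sub _ _ _ _ _ Hth); auto. intros x [c [Hc <-]]; exists c; auto. }
  { intros n [[[p s] [q t]] O1] [Hs [Ht [HO1 [Hne1 [Hp Hq]]]]].
    (* [f] is refined inside [O1], then [h] inside the resulting [O2], so both images stay
       non-meagre throughout [O3]; a ball of radius [rad n / 2] bounds the diameter. *)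
    destruct (refine_piece f s p _ O1 (E (S n)) Hf HO1 Hne1 Hp (proj1 HE _))
      as [k [p' [O2 [H1 [H2 [H3 [H4 [H5 [H6 H7]]]]]]]]].
    destruct (refine_piece h t q (E n) O2 (E (S n)) Hh H4 H5) as
      [k' [q' [O3 [H8 [H9 [H10 [H11 [[z Hz] [H13 H14]]]]]]]]]; [|apply HE|].
    { eapply nonmeagre_throughout_sub; [exact Hq|auto|auto]. }
    exists ((p', s ++ k :: nil), (q', t ++ k' :: nil),
      (fun x => O3 x /\ ball dX z (rad n / 2) x)).
    pose proof (rad_pos n).
    repeat split; eauto.
    - apply open_inter; auto. apply ball_open; auto.
    - exists z; split; auto. apply ball_center; auto; lra.
    - eapply nonmeagre_throughout_sub; [exact H7|auto|]. intros x []; auto.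
    - eapply nonmeagre_throughout_sub; [exact H14|auto|]. intros x []; auto.
    - intros x y [_ Hx] [_ Hy]. unfold ball in *.
      pose proof (dist_tri dX HX x z y). pose proof (dist_sym dX HX x z). lra. }
  pose (p n := fst (fst (fst (u n)))). pose (s n := snd (fst (fst (u n)))).
  pose (q n := fst (snd (fst (u n)))). pose (t n := snd (snd (fst (u n)))).
  (* The open set of stage [n + 1] has pairwise distances below [rad n] and contains the values of
     the points of stage [n + 2]; hence the shift by two. *)
  assert (HR : forall n, A (s n) (p n) /\ A (t n) (q n) /\
    (exists k, s (S n) = s n ++ k :: nil) /\ (exists k, t (S n) = t n ++ k :: nil) /\
    d (p n) (p (S n)) < E n /\ d (q n) (q (S n)) < E n /\
    dX (f (p (S (S n)))) (h (q (S (S n)))) < rad n).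
  { intros n. unfold p, q, s, t. pose proof (Hu n) as H1. pose proof (Hu (S n)) as H2.
    destruct (u n) as [[[p0 s0] [q0 t0]] O0]. destruct (u (S n)) as [[[p1 s1] [q1 t1]] O1].
    destruct (u (S (S n))) as [[[p2 s2] [q2 t2]] O2]. simpl.
    destruct H1 as [H1 H1'], H2 as [_ H2]. intuition. }
  destruct (proj2 (proj2 HA) s p E) as [p_ Hp]; try (intros n; apply HR); auto.
  { unfold s; rewrite Hu0; reflexivity. }
  destruct (proj2 (proj2 HA) t q E) as [q_ Hq]; try (intros n; apply HR); auto.
  { unfold t; rewrite Hu0; reflexivity. }
  exists p_, q_. split; [|split].
  - pose proof (Hp 0%nat) as H. unfold p in H. rewrite Hu0 in H. unfold E in H; simpl in H. lra.
  - pose proof (Hq 0%nat) as H. unfold q in H. rewrite Hu0 in H. unfold E in H; simpl in H. lra.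
  - apply NNPP. intros Hneq. pose proof (dist_pos dX HX _ _ Hneq) as Hpos.
    set (D := dX (f p_) (h q_)) in *.
    destruct (Hfc p_ (D / 3)) as [d1 [Hd1 H1]]; [lra|].
    destruct (Hhc q_ (D / 3)) as [d2 [Hd2 H2]]; [lra|].
    destruct (halving_small E HE (Rmin d1 d2 / 2)) as [N HN].
    { pose proof (Rmin_glb_lt _ _ _ Hd1 Hd2); lra. }
    destruct (rad_small (D / 3)) as [M HM]; [lra|].
    set (n := max N M).
    pose proof (halving_decr E HE N (S (S n)) ltac:(lia)).
    pose proof (rad_decr M n ltac:(lia)).
    destruct (HR n) as [_ [_ [_ [_ [_ [_ H3]]]]]].
    pose proof (Rmin_l d1 d2). pose proof (Rmin_r d1 d2).
    pose proof (H1 (p (S (S n)))) as Hpn. rewrite (dist_sym d Hd) in Hpn.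
    pose proof (H2 (q (S (S n)))) as Hqn. rewrite (dist_sym d Hd) in Hqn.
    pose proof (Hp (S (S n))). pose proof (Hq (S (S n))).
    pose proof (dist_tri dX HX (f p_) (f (p (S (S n)))) (h q_)).
    pose proof (dist_tri dX HX (f (p (S (S n)))) (h (q (S (S n)))) (h q_)).
    rewrite (dist_sym dX HX (h (q (S (S n)))) (h q_)) in *.
    unfold D in *. lra.
Qed.

End Scheme.

(** * Normed groups acting on a metric space *)

Section Action.
Context {G X : Type} (mul : G -> G -> G) (inv : G -> G) (e : G)
  (nrm : G -> R) (dX : X -> X -> R) (phi : G -> X -> X)
  (Hgrp : is_group mul inv e) (Hnrm : is_group_norm mul inv e nrm)
  (HX : is_metric dX) (Hact : is_action mul e phi)
  (Hcont : sep_continuous (dR mul inv nrm) dX phi).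

Local Notation d := (dR mul inv nrm).

Lemma mul_assoc a b c : mul a (mul b c) = mul (mul a b) c.
Proof. apply Hgrp. Qed.
Lemma mul_1l a : mul e a = a.
Proof. apply Hgrp. Qed.
Lemma mul_1r a : mul a e = a.
Proof. apply Hgrp. Qed.
Lemma mul_invl a : mul (inv a) a = e.
Proof. apply Hgrp. Qed.
Lemma mul_invr a : mul a (inv a) = e.
Proof. apply Hgrp. Qed.

Lemma mul_invK a b : mul (inv a) (mul a b) = b.
Proof. rewrite mul_assoc, mul_invl, mul_1l; auto. Qed.
Lemma inv_unique a b : mul a b = e -> b = inv a.
Proof. intros H. rewrite <- (mul_invK a b), H, mul_1r; auto. Qed.
Lemma inv_mul a b : inv (mul a b) = mul (inv b) (inv a).
Proof.
  symmetry; apply inv_unique.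
  rewrite <- (mul_assoc a), (mul_assoc b), mul_invr, mul_1l, mul_invr; auto.
Qed.
Lemma inv_inv a : inv (inv a) = a.
Proof. symmetry; apply inv_unique, mul_invl. Qed.
Lemma nrm_mul a b : nrm (mul a b) <= nrm a + nrm b.
Proof. apply Hnrm. Qed.
Lemma nrm_inv a : nrm (inv a) = nrm a.
Proof. apply Hnrm. Qed.
Lemma nrm_e : nrm e = 0.
Proof. apply Hnrm. Qed.

Lemma dR_mull b g : d g (mul b g) = nrm b.
Proof. unfold dR. rewrite inv_mul, mul_assoc, mul_invr, mul_1l. apply nrm_inv. Qed.

Lemma dR_e b : d e b = nrm b.
Proof. rewrite <- (dR_mull b e), mul_1r; auto. Qed.

Lemma dR_metric : is_metric d.
Proof.
  unfold dR. split; [intros; apply Hnrm|]. split; [|split].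
  - intros x y; split.
    + intros H. destruct (classic (mul x (inv y) = e)) as [E|E].
      * rewrite <- (mul_1r x), <- (mul_invl y), mul_assoc, E, mul_1l; auto.
      * pose proof (proj1 (proj2 (proj2 Hnrm)) _ E). lra.
    + intros ->. rewrite mul_invr. apply nrm_e.
  - intros x y. rewrite <- nrm_inv, inv_mul, inv_inv; auto.
  - intros x y z. replace (mul x (inv z)) with (mul (mul x (inv y)) (mul y (inv z))).
    + apply nrm_mul.
    + rewrite <- mul_assoc, mul_invK; auto.
Qed.

Lemma act_e x : phi e x = x.
Proof. apply Hact. Qed.
Lemma act_mul g h x : phi (mul g h) x = phi g (phi h x).
Proof. apply Hact. Qed.
Lemma act_invK g x : phi (inv g) (phi g x) = x.
Proof. rewrite <- act_mul, mul_invl; apply act_e. Qed.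
Lemma act_Kinv g x : phi g (phi (inv g) x) = x.
Proof. rewrite <- act_mul, mul_invr; apply act_e. Qed.

Lemma act_near_e x eps : 0 < eps ->
  exists delta, 0 < delta /\ forall b, nrm b < delta -> dX x (phi b x) < eps.
Proof.
  intros He. destruct (proj2 Hcont x e eps He) as [delta [Hd H]].
  exists delta; split; auto. intros b Hb. rewrite act_e in H. apply H. rewrite dR_e; auto.
Qed.

Lemma open_translate g U : mopen dX U -> mopen dX (fun x => U (phi g x)).
Proof.
  intros HU x Hx. destruct (HU _ Hx) as [eps [He H]].
  destruct (proj1 Hcont g x eps He) as [delta [Hd H']]. exists delta; auto.
Qed.

Lemma nowhere_dense_translate g N : nowhere_dense dX N -> nowhere_dense dX (fun x => N (phi g x)).
Proof.
  intros HN U HU Hcl y Hy.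
  apply (HN (fun x => U (phi (inv g) x)) (open_translate _ _ HU)) with (y := phi g y).
  - intros z Hz eps He. destruct (proj1 Hcont g (phi (inv g) z) eps He) as [delta [Hd H]].
    destruct (Hcl _ Hz delta Hd) as [w [Hw1 Hw2]]. exists (phi g w); split; auto.
    rewrite <- (act_Kinv g z) at 1. auto.
  - rewrite act_invK; auto.
Qed.

Lemma meagre_translate g S : meagre dX S -> meagre dX (fun x => S (phi g x)).
Proof.
  intros [N [H1 H2]]. exists (fun n x => N n (phi g x)). split.
  - intros n. apply nowhere_dense_translate; auto.
  - intros x Hx; auto.
Qed.

Lemma nonmeagre_throughout_translate g S O : nonmeagre_throughout dX S O ->
  nonmeagre_throughout dX (fun x => S (phi g x)) (fun x => O (phi g x)).
Proof.
  intros H U HU [u Hu] HUO Hm.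
  apply (H (fun x => U (phi (inv g) x)) (open_translate _ _ HU)).
  - exists (phi g u). rewrite act_invK; auto.
  - intros x Hx. rewrite <- (act_Kinv g x). auto.
  - apply (meagre_sub dX _ _ (meagre_translate (inv g) _ Hm)).
    intros x [H1 H2]. rewrite act_Kinv. auto.
Qed.

(** * Orbits of small balls and the passage to micro-transitivity *)

Definition small_orbit (s : R) (x : X) : X -> Prop := img (fun g => phi g x) (ball d e s).

Lemma small_orbit_intro s x b : nrm b < s -> small_orbit s x (phi b x).
Proof. intros H. exists b; split; auto. unfold ball. rewrite dR_e; auto. Qed.

(** From [g y = b x] follows [y = g^{-1} b x], and the norm is symmetric and subadditive. *)
Lemma small_orbit_translate s t x g y : nrm g < t ->
  small_orbit s x (phi g y) -> small_orbit (t + s) x y.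
Proof.
  intros Hg [b [Hb E]]. unfold ball in Hb. rewrite dR_e in Hb.
  rewrite <- (act_invK g y), <- E, <- act_mul. apply small_orbit_intro.
  pose proof (nrm_mul (inv g) b). rewrite nrm_inv in *. lra.
Qed.

(** Openness at [a x] follows from the neighbourhood property there, since right invariance puts
    [b a] at distance [nrm b] from [a]. *)
Lemma micro_transitivity :
  (forall s x, 0 < s -> mnbhs dX x (small_orbit s x)) -> conclusionE d dX e phi.
Proof.
  intros H.
  assert (H1 : forall U, mopen d U -> U e -> forall x, mnbhs dX x (orbit_set phi U x)).
  { intros U HU He x. destruct (HU e He) as [s [Hs HsU]].
    destruct (H s x Hs) as [V [HV [HVx HVs]]]. exists V; split; auto. split; auto.
    intros y Hy. destruct (HVs y Hy) as [b [Hb <-]]. exists b; split; auto. }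
  split; [exact H1|split].
  - intros x A HA y [a [Ha <-]]. destruct (HA a Ha) as [s [Hs HsA]].
    destruct (H s (phi a x) Hs) as [V [HV [HVx HVs]]].
    destruct (HV _ HVx) as [eps [He HeV]]. exists eps; split; auto.
    intros y Hy. destruct (HVs y (HeV y Hy)) as [b [Hb <-]].
    exists (mul b a). split; [|apply act_mul]. apply HsA. rewrite dR_mull.
    unfold ball in Hb. rewrite dR_e in Hb; auto.
  - intros x A [U [HU [HUe HUA]]]. destruct (H1 U HU HUe x) as [V [HV [HVx HVs]]].
    exists V; split; auto. split; auto. intros y Hy.
    destruct (HVs y Hy) as [b [Hb <-]]. exists b; auto.
Qed.

Lemma open_nonmeagre : (forall s x, 0 < s -> ~ meagre dX (small_orbit s x)) ->
  forall U x, mopen dX U -> U x -> ~ meagre dX U.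
Proof.
  intros H U x HU Hx Hm. destruct (HU x Hx) as [eps [He HeU]].
  destruct (act_near_e x eps He) as [s [Hs HsU]]. apply (H s x Hs).
  apply (meagre_sub dX _ _ Hm). intros y [b [Hb <-]]. apply HeU, HsU.
  unfold ball in Hb. rewrite dR_e in Hb; auto.
Qed.

Lemma conclusion_of_nikodym : nikodym_action d dX e phi -> conclusionE d dX e phi.
Proof.
  intros HN.
  assert (HB : forall s x, 0 < s -> exists B, (forall y, B y -> small_orbit s x y) /\
    ~ meagre dX B /\ baire_property dX B).
  { intros s x Hs. destruct (HN (ball d e s) (ball_open d dR_metric e s)
      (ball_center d dR_metric e s Hs) x) as [B [H1 H2]].
    exists B; split; auto. }
  assert (Hnm : forall s x, 0 < s -> ~ meagre dX (small_orbit s x)).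
  { intros s x Hs Hm. destruct (HB s x Hs) as [B [H1 [H2 _]]].
    exact (H2 (meagre_sub dX _ _ Hm H1)). }
  (* translating by an element of [B] brings the open set where [B] is comeagre to [x] *)
  assert (HW : forall s x, 0 < s -> exists W, mopen dX W /\ W x /\
    meagre dX (fun y => W y /\ ~ small_orbit (s + s) x y)).
  { intros s x Hs. destruct (HB s x Hs) as [B [H1 [H2 [U [HU HUB]]]]].
    assert (Hy : exists y, B y /\ U y).
    { apply NNPP. intros Hno. apply H2. apply (meagre_sub dX _ _ HUB).
      intros y Hy. left; split; auto. eauto. }
    destruct Hy as [y [HBy HUy]]. destruct (H1 y HBy) as [g [Hg <-]].
    unfold ball in Hg. rewrite dR_e in Hg.
    exists (fun z => U (phi g z)). split; [apply open_translate; auto|]. split; auto.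
    apply (meagre_sub dX _ _ (meagre_translate g _ HUB)).
    intros z [Hz1 Hz2]. right; split; auto. intros HBz. apply Hz2.
    apply (small_orbit_translate s s x g); auto. }
  apply micro_transitivity. intros s x Hs.
  destruct (HW (s / 4) x) as [W [HW1 [HW2 HW3]]]; [lra|].
  exists W; split; auto. split; auto. intros y Hy.
  destruct (HW (s / 4) y) as [W' [HW1' [HW2' HW3']]]; [lra|].
  destruct (nonmeagre_inhabited dX (fun z => small_orbit (s / 4 + s / 4) x z /\
    small_orbit (s / 4 + s / 4) y z)) as [z [Hzx [b [Hb <-]]]].
  { intros Hm. apply (open_nonmeagre Hnm _ y (open_inter dX _ _ HW1 HW1')); auto.
    apply (meagre_sub dX _ _ (meagre_union dX _ _ Hm (meagre_union dX _ _ HW3 HW3'))).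
    intros z [H1 H2]. tauto. }
  unfold ball in Hb. rewrite dR_e in Hb.
  replace s with (s / 4 + s / 4 + (s / 4 + s / 4)) by lra.
  apply (small_orbit_translate _ _ x b); auto.
Qed.

Lemma conclusion_of_nonmeagre (A : list nat -> G -> Prop) : souslin_scheme d A ->
  (forall x, base_sigma_discrete d dX (fun g => phi g x)) ->
  (forall s x, 0 < s -> ~ meagre dX (small_orbit s x)) -> conclusionE d dX e phi.
Proof.
  intros HA Hb Hnm.
  assert (HW : forall s x, 0 < s -> exists W, mopen dX W /\ W x /\
    nonmeagre_throughout dX (small_orbit (s + s) x) W).
  { intros s x Hs.
    destruct (nonmeagre_throughout_somewhere dX _ HX (Hnm s x Hs)) as [O [HO [Hne Hth]]].
    destruct (nonmeagre_inhabited dX _ (Hth O HO Hne (fun y h => h))) as [y [[g [Hg <-]] HOy]].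
    unfold ball in Hg. rewrite dR_e in Hg.
    exists (fun z => O (phi g z)). split; [apply open_translate; auto|]. split; auto.
    apply (nonmeagre_throughout_sub dX _ _ _ _ (nonmeagre_throughout_translate g _ _ Hth)); auto.
    intros z Hz. apply (small_orbit_translate s s x g); auto. }
  apply micro_transitivity. intros s x Hs.
  (* [HW] doubles the radius to [s / 8] and the limits in [images_meet] double it to at most
     [s / 4], below the two halves [s / 2] that add up to [s]. *)
  destruct (HW (s / 16) x) as [W [HW1 [HW2 HW3]]]; [lra|].
  exists W; split; auto. split; auto. intros y Hy.
  destruct (HW (s / 16) y) as [W' [HW1' [HW2' HW3']]]; [lra|].
  destruct (images_meet d dR_metric dX HX A HA (fun g => phi g x) (fun g => phi g y) e e
    (s / 16 + s / 16) (fun z => W z /\ W' z)) as [p [q [Hp [Hq E]]]]; auto.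
  - apply Hcont.
  - apply Hcont.
  - lra.
  - apply open_inter; auto.
  - exists y; auto.
  - apply (nonmeagre_throughout_sub dX _ _ _ _ HW3); tauto.
  - apply (nonmeagre_throughout_sub dX _ _ _ _ HW3'); tauto.
  - rewrite dR_e in Hp, Hq. replace s with (s / 2 + s / 2) by lra.
    apply (small_orbit_translate _ _ x q); [lra|]. rewrite <- E.
    apply small_orbit_intro; lra.
Qed.

(** If nowhere dense sets cover the orbit, the preimages of their closures under [g |-> phi g x] are
    closed and cover the ball. The hypothesis on [K], applied at [phi g x], keeps them from
    containing a ball, so the ball is meagre although [G] is Baire. *)
Lemma small_orbit_nonmeagre : baire_space d ->
  (forall K, mclosed dX K -> nowhere_dense dX K -> forall r x, 0 < r ->
     exists b, nrm b < r /\ ~ K (phi b x)) ->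
  forall s x, 0 < s -> ~ meagre dX (small_orbit s x).
Proof.
  intros HG HK s x Hs [N [HN Hcov]].
  assert (Hclosed : forall n, mclosed dX (mclosure dX (N n))).
  { intros n y Hy. apply NNPP. intros Hno. apply Hy. intros eps He.
    apply NNPP. intros Hno'. apply Hno. exists (eps / 2). split; [lra|].
    intros z Hz Hcl. destruct (Hcl (eps / 2)) as [w [Hw1 Hw2]]; [lra|].
    apply Hno'. exists w; split; auto. pose proof (dist_tri dX HX y z w). lra. }
  assert (Hnd : forall n, nowhere_dense dX (mclosure dX (N n))).
  { intros n U HU Hcl. apply (HN n U HU). intros y Hy eps He.
    destruct (Hcl y Hy (eps / 2)) as [z [Hz1 Hz2]]; [lra|].
    destruct (Hz1 (eps / 2)) as [w [Hw1 Hw2]]; [lra|]. exists w; split; auto.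
    pose proof (dist_tri dX HX y z w). lra. }
  apply (HG (ball d e s) (ball_open d dR_metric e s)).
  { exists e. apply ball_center; auto. apply dR_metric. }
  exists (fun n g => mclosure dX (N n) (phi g x)). split.
  - intros n U HU Hcl g Hg. destruct (HU g Hg) as [r [Hr HrU]].
    destruct (HK _ (Hclosed n) (Hnd n) r (phi g x) Hr) as [b [Hb HKb]].
    assert (HUb : U (mul b g)) by (apply HrU; rewrite dR_mull; auto).
    destruct (Hclosed n _ HKb) as [eps [He Hfar]].
    destruct (proj2 Hcont x (mul b g) eps He) as [delta [Hd Hnear]].
    destruct (Hcl _ HUb delta Hd) as [a [Ha1 Ha2]].
    apply (Hfar (phi a x)); auto. rewrite <- act_mul. auto.
  - intros g Hg. destruct (Hcov (phi g x)) as [n Hn].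
    + exists g; auto.
    + exists n. intros eps He. exists (phi g x); split; auto. rewrite dist_refl; auto.
Qed.

End Action.

(** * Orbits of small balls are not contained in closed nowhere dense sets *)

(** [L k] lists the first [k + 1] terms; term [k + 1] applies the operation coded by [k] to two
    earlier terms, whose indices the pairing keeps at most [k]. *)
Lemma countable_closure {T : Type} (F : nat -> T -> T -> T) (a : T) :
  exists u : nat -> T, u 0%nat = a /\ forall n i j, exists k, u k = F n (u i) (u j).
Proof.
  pose (code k := let (n, ij) := Cantor.of_nat k in (n, Cantor.of_nat ij)).
  pose (L := fix L k := match k with
    | O => a :: nil
    | S k => L k ++ let '(n, (i, j)) := code k in F n (nth i (L k) a) (nth j (L k) a) :: nil
    end).
  assert (HL : forall k, length (L k) = S k).
  { induction k as [|k IH]; [reflexivity|]. simpl. rewrite length_app, IH.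
    destruct (code k) as [n [i j]]. simpl. lia. }
  assert (Hpre : forall k i, (i <= k)%nat -> nth i (L k) a = nth i (L i) a).
  { intros k i H. induction H as [|k H IH]; auto.
    simpl. rewrite app_nth1; auto. rewrite HL; lia. }
  exists (fun k => nth k (L k) a). split; [reflexivity|]. intros n i j.
  exists (S (Cantor.to_nat (n, Cantor.to_nat (i, j)))).
  set (k := Cantor.to_nat (n, Cantor.to_nat (i, j))).
  assert (Hk : code k = (n, (i, j))).
  { unfold code, k. rewrite !Cantor.cancel_of_to. reflexivity. }
  pose proof (Cantor.to_nat_non_decreasing n (Cantor.to_nat (i, j))).
  pose proof (Cantor.to_nat_non_decreasing i j).
  assert (Hij : (i <= k /\ j <= k)%nat) by (unfold k; lia).
  change (L (S k)) with (L k ++ let '(n, (i, j)) := code k in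
    F n (nth i (L k) a) (nth j (L k) a) :: nil).
  rewrite Hk, app_nth2; rewrite HL; [|lia].
  rewrite Nat.sub_diag. cbn [nth]. rewrite (Hpre k i), (Hpre k j) by lia. reflexivity.
Qed.

Lemma list_nat_enum : exists U : nat -> list nat, forall s, exists c, U c = s.
Proof.
  destruct (countable_closure (fun n s _ => s ++ n :: nil) (@nil nat)) as [U [H0 HU]].
  exists U. induction s as [|n s [c <-]] using rev_ind; [eauto|]. exact (HU n c c).
Qed.

Section SmallOrbits.
Context {G X : Type} (mul : G -> G -> G) (inv : G -> G) (e : G)
  (nrm : G -> R) (dX : X -> X -> R) (phi : G -> X -> X)
  (Hgrp : is_group mul inv e) (Hnrm : is_group_norm mul inv e nrm)
  (HX : is_metric dX) (Hact : is_action mul e phi)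
  (Hcont : sep_continuous (dR mul inv nrm) dX phi)
  (Htrans : transitive_action phi)
  (Hbsd : forall x, base_sigma_discrete (dR mul inv nrm) dX (fun g => phi g x))
  (A : list nat -> G -> Prop) (HA : souslin_scheme (dR mul inv nrm) A).

Local Notation d := (dR mul inv nrm).
Let Hd : is_metric d := dR_metric mul inv e nrm Hgrp Hnrm.

Context (x0 : X) (K : X -> Prop) (HKclosed : mclosed dX K) (HKnd : nowhere_dense dX K)
  (r : R) (Hr : 0 < r) (HK : forall b, nrm b < r -> K (phi b x0)).

Let f : G -> X := fun g => phi g x0.
Let heavy (s : list nat) : G -> Prop := heavy_point d dX f (A s).

Lemma meagre_image_not_heavy_piece s : meagre dX (img f (fun a => A s a /\ ~ heavy s a)).
Proof. apply meagre_image_not_heavy; auto; apply Hbsd. Qed.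

(** The [u k] form a countable subgroup closed under the choices made later. By the last clause, a
    heavy part near [u i] with non-meagre image yields a ball about some [f (u j)] in which every
    orbit point is a limit of values of subgroup elements from that part. *)
Definition dense_witnesses (u : nat -> G) : Prop :=
  (forall i j, exists k, u k = mul (u i) (u j)) /\
  (forall i, exists k, u k = inv (u i)) /\
  (exists k, heavy nil (u k)) /\
  (forall i m, exists k, dX (f (u i)) (f (u k)) < rad m /\ ~ K (f (u k))) /\
  (forall s i m, ~ meagre dX (img f (fun a => heavy s a /\ d (u i) a < rad m)) ->
     exists j l, forall k n, dX (f (u j)) (f (u k)) < rad l ->
       exists k', heavy s (u k') /\ d (u i) (u k') < rad m /\ dX (f (u k)) (f (u k')) < rad n).

Lemma dense_witnesses_exist : ~ meagre dX (fun _ => True) -> exists u, dense_witnesses u.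
Proof.
  intros Hnm. destruct list_nat_enum as [U HU].
  assert (Hstart : exists g, heavy nil g).
  { apply NNPP. intros Hno. apply Hnm.
    apply (meagre_sub dX _ _ (meagre_image_not_heavy_piece nil)).
    intros y _. destruct (Htrans x0 y) as [g <-]. exists g. split; auto. split; [apply HA|eauto]. }
  destruct Hstart as [g0 Hg0].
  pose (near s m x y l g := heavy s g /\ d x g < rad m /\ dX (f y) (f g) < rad l).
  pose (center s m x g := heavy s g /\ d x g < rad m /\ exists l, forall z n,
    dX (f g) (f z) < rad l -> exists c, near s m x z n c).
  (* Each clause contributes one operation, selected by [t], with radii and the list [U c] as
     parameters; the subgroup is the Skolem hull of [g0] under them. *)
  pose (op (t m l c : nat) (x y : G) := match t with
    | 0%nat => mul x y
    | 1%nat => inv x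
    | 2%nat => epsilon (inhabits e) (fun g => dX (f x) (f g) < rad m /\ ~ K (f g))
    | 3%nat => epsilon (inhabits e) (near (U c) m x y l)
    | _ => epsilon (inhabits e) (center (U c) m x)
    end).
  pose (dec n := let (t, n) := Cantor.of_nat n in let (m, n) := Cantor.of_nat n in
    let (l, c) := Cantor.of_nat n in op t m l c).
  destruct (countable_closure dec g0) as [u [Hu0 Hu]].
  assert (Hop : forall t m l c i j, exists k, u k = op t m l c (u i) (u j)).
  { intros t m l c i j.
    destruct (Hu (Cantor.to_nat (t, Cantor.to_nat (m, Cantor.to_nat (l, c)))) i j) as [k Hk].
    exists k. rewrite Hk. unfold dec. rewrite !Cantor.cancel_of_to. reflexivity. }
  exists u. repeat split.
  - intros i j. exact (Hop 0 0 0 0 i j)%nat.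
  - intros i. exact (Hop 1 0 0 0 i i)%nat.
  - exists 0%nat. rewrite Hu0; auto.
  - intros i m. destruct (Hop 2 m 0 0 i i)%nat as [k Hk]. exists k. rewrite Hk. simpl.
    apply epsilon_spec. apply NNPP. intros Hno.
    apply (HKnd (ball dX (f (u i)) (rad m))) with (y := f (u i)).
    + apply ball_open; auto.
    + intros y Hy. assert (HKy : K y).
      { apply NNPP. intros Hy'. destruct (Htrans x0 y) as [g <-]. apply Hno. exists g; auto. }
      intros eps He. exists y; split; auto. rewrite dist_refl; auto.
    + apply ball_center; auto. apply rad_pos.
  - intros s i m Hm. destruct (HU s) as [c <-].
    (* A non-meagre image is dense in some open [O]; any element of the part with value in [O]
       serves as centre. *)
    destruct (not_nowhere_dense dX _ (fun H => Hm (meagre_nowhere_dense dX _ H)))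
      as [O [HO [[y Hy] Hcl]]].
    assert (Hcenter : exists g, center (U c) m (u i) g).
    { destruct (HO y Hy) as [eps [He HeO]].
      destruct (Hcl y Hy eps He) as [y' [[g [[Hg1 Hg2] <-]] Hy']].
      exists g. split; auto. split; auto.
      destruct (HO _ (HeO _ Hy')) as [eps' [He' HeO']].
      destruct (rad_small eps' He') as [l Hl]. exists l. intros z n Hz.
      destruct (Hcl (f z) (HeO' _ (Rlt_trans _ _ _ Hz Hl)) (rad n) (rad_pos n))
        as [y'' [[g' [[Hg1' Hg2'] <-]] Hy'']].
      exists g'; split; auto. }
    destruct (Hop 4%nat m 0%nat c i i) as [j Hj]. simpl in Hj.
    pose proof (epsilon_spec (inhabits e) _ Hcenter) as Hspec. rewrite <- Hj in Hspec.
    destruct Hspec as [_ [_ [l Hl]]]. exists j, l. intros k n Hk.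
    destruct (Hop 3%nat m n c i k) as [k' Hk']. simpl in Hk'. exists k'.
    pose proof (epsilon_spec (inhabits e) _ (Hl (u k) n Hk)) as Hspec.
    rewrite <- Hk' in Hspec. exact Hspec.
Qed.

(** * Generic limits of the countable subgroup and the closure of its orbit *)

Context (u : nat -> G) (Hu : dense_witnesses u).

Let XN : X -> Prop := mclosure dX (fun y => exists k, y = f (u k)).

(** For closed [F] this is nowhere density relative to [XN], tested on the dense set of orbit
    points. *)
Definition thin (F : X -> Prop) : Prop := mclosed dX F /\
  forall k eps, 0 < eps -> exists k', dX (f (u k)) (f (u k')) < eps /\ ~ F (f (u k')).

Definition preserves_XN (g : G) : Prop :=
  (forall w, XN w -> XN (phi g w)) /\ (forall w, XN w -> XN (phi (inv g) w)).

Lemma XN_orbit k : XN (f (u k)).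
Proof. intros eps He. exists (f (u k)). split; [eauto|]. rewrite dist_refl; auto. Qed.

Lemma XN_closed w : (forall eps, 0 < eps -> exists v, XN v /\ dX w v < eps) -> XN w.
Proof.
  intros H eps He. destruct (H (eps / 2)) as [v [Hv Hwv]]; [lra|].
  destruct (Hv (eps / 2)) as [y [Hy Hvy]]; [lra|]. exists y; split; auto.
  pose proof (dist_tri dX HX w v y). lra.
Qed.

Lemma XN_translate g : (forall k, XN (phi g (f (u k)))) -> forall w, XN w -> XN (phi g w).
Proof.
  intros H w Hw. apply XN_closed. intros eps He.
  destruct (proj1 Hcont g w eps He) as [delta [Hdl Hg]].
  destruct (Hw delta Hdl) as [y [[k ->] Hy]]. eauto.
Qed.

Lemma preserves_XN_inv g : preserves_XN g -> preserves_XN (inv g).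
Proof.
  intros [H1 H2]. split; auto. rewrite (inv_inv mul inv e Hgrp). auto.
Qed.

Lemma preserves_XN_orbit k : preserves_XN (u k).
Proof.
  destruct Hu as [Hmul [Hinv _]]. split; apply XN_translate; intros j; unfold f.
  - rewrite <- (act_mul mul e phi Hact). destruct (Hmul k j) as [i <-]. apply XN_orbit.
  - destruct (Hinv k) as [k' <-]. rewrite <- (act_mul mul e phi Hact).
    destruct (Hmul k' j) as [i <-]. apply XN_orbit.
Qed.

Lemma XN_base : XN x0.
Proof.
  rewrite <- (act_invK mul inv e phi Hgrp Hact (u 0%nat) x0).
  apply preserves_XN_orbit, (XN_orbit 0%nat).
Qed.

(** A Baire category argument on the subgroup, with convergence supplied by the Souslin scheme.
    Stage [n] moves from a heavy element of [A s] to a nearby heavy element of a child, around which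
    a whole ball satisfies condition [n]. *)
Lemma generic_point (V : nat -> G -> Prop) (F : nat -> X -> Prop) :
  (forall n, mopen d (V n)) -> (forall n k, V n (u k)) -> (forall n, thin (F n)) ->
  exists xi, forall n, V n xi /\ ~ F n (f xi).
Proof.
  intros HVo HVu HF. destruct Hu as [_ [_ [[k0 Hk0] [_ Hdense]]]].
  destruct (dependent_choice (T := nat * list nat * R)
    (fun n '(k, s, eps) => heavy s (u k) /\ 0 < eps)
    (fun n '(k, s, eps) '(k', s', eps') => (exists j, s' = s ++ j :: nil) /\
       d (u k) (u k') < eps /\ eps' <= eps / 2 /\
       forall a, d (u k') a <= 2 * eps' -> V n a /\ ~ F n (f a))
    (k0, nil, 1)) as [v [Hv0 Hv]].
  { split; auto; lra. }
  { intros n [[k s] eps] [Hk He]. destruct (rad_small eps He) as [m Hm].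
    (* Some child keeps a non-meagre heavy part near [u k], because the non-heavy points of all
       children have only a meagre set of values. *)
    assert (Hj : exists j, ~ meagre dX
      (img f (fun a => heavy (s ++ j :: nil) a /\ d (u k) a < rad m))).
    { apply NNPP. intros Hno. apply (proj2 Hk m).
      apply (meagre_sub dX _ (fun y => exists j,
        img f (fun a => heavy (s ++ j :: nil) a /\ d (u k) a < rad m) y \/
        img f (fun a => A (s ++ j :: nil) a /\ ~ heavy (s ++ j :: nil) a) y)).
      - apply meagre_iUnion. intros j. apply meagre_union.
        + apply NNPP. eauto.
        + apply meagre_image_not_heavy_piece.
      - intros y [a [[Ha1 Ha2] <-]]. destruct (proj1 (proj2 HA) s a Ha1) as [j Hj].
        exists j. destruct (classic (heavy (s ++ j :: nil) a)); [left|right]; exists a; auto. }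
    destruct Hj as [j Hj]. destruct (Hdense _ _ _ Hj) as [i [l Hl]].
    (* Thinness gives an orbit point outside [F n] in the ball just found, and density there gives a
       heavy [u k'] whose value is close enough to miss [F n] too. *)
    destruct (proj2 (HF n) i (rad l) (rad_pos l)) as [i' [Hi'1 Hi'2]].
    destruct (proj1 (HF n) _ Hi'2) as [eta [Heta Hfar]].
    destruct (rad_small eta Heta) as [p Hp].
    destruct (Hl i' p Hi'1) as [k' [Hk'1 [Hk'2 Hk'3]]].
    destruct (proj1 (HF n) (f (u k')) (Hfar _ (Rlt_trans _ _ _ Hk'3 Hp))) as [e1 [He1 Hfar1]].
    destruct (proj2 Hcont x0 (u k') e1 He1) as [e2 [He2 Hnear]].
    destruct (HVo n _ (HVu n k')) as [e3 [He3 HV3]].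
    (* The limit will be within [2 * eps'] of [u k']; the quarters keep this below [e2] and [e3]. *)
    pose (eps' := Rmin (eps / 2) (Rmin (e2 / 4) (e3 / 4))).
    assert (Heps' : eps' <= eps / 2 /\ eps' <= e2 / 4 /\ eps' <= e3 / 4).
    { unfold eps'. pose proof (Rmin_l (eps / 2) (Rmin (e2 / 4) (e3 / 4))).
      pose proof (Rmin_r (eps / 2) (Rmin (e2 / 4) (e3 / 4))).
      pose proof (Rmin_l (e2 / 4) (e3 / 4)). pose proof (Rmin_r (e2 / 4) (e3 / 4)). lra. }
    assert (0 < eps') by (unfold eps'; repeat apply Rmin_glb_lt; lra).
    exists (k', s ++ j :: nil, eps'). repeat split; eauto; try lra; try apply Hk'1.
    - apply HV3. lra.
    - apply Hfar1, Hnear. lra. }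
  pose (g n := u (fst (fst (v n)))). pose (s n := snd (fst (v n))). pose (eps n := snd (v n)).
  assert (Hstep : forall n, A (s n) (g n) /\ 0 < eps n /\ (exists j, s (S n) = s n ++ j :: nil) /\
    d (g n) (g (S n)) < eps n /\ eps (S n) <= eps n / 2 /\
    forall a, d (g (S n)) a <= 2 * eps (S n) -> V n a /\ ~ F n (f a)).
  { intros n. unfold g, s, eps. pose proof (Hv n) as H.
    destruct (v n) as [[k1 s1] eps1]. destruct (v (S n)) as [[k2 s2] eps2].
    destruct H as [[[HA1 _] H2] [H3 [H4 [H5 H6]]]]. simpl. repeat split; auto; apply H6; auto. }
  destruct (proj2 (proj2 HA) s g eps) as [xi Hxi].
  - unfold s; rewrite Hv0; reflexivity.
  - intros n; apply Hstep.
  - intros n; apply Hstep.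
  - split; intros n; apply Hstep.
  - intros n; apply Hstep.
  - exists xi. intros n. apply Hstep, Hxi.
Qed.

Lemma open_eval x y eps : mopen d (fun g => dX (phi g x) y < eps).
Proof.
  intros g Hg. destruct (proj2 Hcont x g (eps - dX (phi g x) y)) as [delta [Hdl H]]; [lra|].
  exists delta; split; auto. intros h Hh. pose proof (H h Hh).
  pose proof (dist_tri dX HX (phi h x) (phi g x) y).
  pose proof (dist_sym dX HX (phi h x) (phi g x)). lra.
Qed.

Lemma open_exists (P : nat -> G -> Prop) :
  (forall k, mopen d (P k)) -> mopen d (fun g => exists k, P k g).
Proof.
  intros H g [k Hk]. destruct (H k g Hk) as [eps [He HP]]. exists eps; eauto.
Qed.

(* The conditions [dX (phi xi (phi (inv (u k)) y)) y < eps] are open in [xi] and hold at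
   [xi = u k]; they give [phi (inv (u k)) y -> phi (inv xi) y], so that [inv xi] maps [XN]
   into itself although inversion need not be continuous. *)
Lemma generic_unit (V : nat -> G -> Prop) (F : nat -> X -> Prop) :
  (forall n, mopen d (V n)) -> (forall n k, V n (u k)) -> (forall n, thin (F n)) ->
  exists xi, preserves_XN xi /\ forall n, V n xi /\ ~ F n (f xi).
Proof.
  intros HVo HVu HF.
  pose (V1 c g := let (j, n) := Cantor.of_nat c in
    exists k, dX (phi g (phi (inv (u k)) (f (u j)))) (f (u j)) < rad n).
  pose (V2 c g := let (j, n) := Cantor.of_nat c in
    exists k, dX (phi g (f (u j))) (phi (u k) (f (u j))) < rad n).
  destruct (generic_point (fun n g => V n g /\ V1 n g /\ V2 n g) F) as [xi Hxi]; auto.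
  - intros n. apply open_inter; auto. apply open_inter; unfold V1, V2;
      destruct (Cantor.of_nat n) as [j m]; apply open_exists; intros k; apply open_eval.
  - intros n k. split; auto. unfold V1, V2. destruct (Cantor.of_nat n) as [j m].
    split; exists k.
    + rewrite (act_Kinv mul inv e phi Hgrp Hact), dist_refl; auto. apply rad_pos.
    + rewrite dist_refl; auto. apply rad_pos.
  - exists xi. split; [|intros n; split; apply Hxi].
    assert (H12 : forall j n,
      (exists k, dX (phi xi (phi (inv (u k)) (f (u j)))) (f (u j)) < rad n) /\
      (exists k, dX (phi xi (f (u j))) (phi (u k) (f (u j))) < rad n)).
    { intros j n. destruct (Hxi (Cantor.to_nat (j, n))) as [[_ [H1 H2]] _].
      unfold V1 in H1. unfold V2 in H2. rewrite Cantor.cancel_of_to in H1, H2. auto. }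
    split; apply XN_translate; intros j; apply XN_closed; intros eps He.
    + destruct (rad_small eps He) as [n Hn]. destruct (proj2 (H12 j n)) as [k Hk].
      exists (phi (u k) (f (u j))). split; [|lra]. apply preserves_XN_orbit, XN_orbit.
    + destruct (proj1 Hcont (inv xi) (f (u j)) eps He) as [delta [Hdl Hnear]].
      destruct (rad_small delta Hdl) as [n Hn]. destruct (proj1 (H12 j n)) as [k Hk].
      exists (phi (inv (u k)) (f (u j))). split; [apply preserves_XN_orbit, XN_orbit|].
      rewrite <- (act_invK mul inv e phi Hgrp Hact xi (phi (inv (u k)) (f (u j)))).
      apply Hnear. rewrite dist_sym; auto. lra.
Qed.

(** [g] maps [XN] onto itself: an orbit point is moved by [g], replaced by a close orbit point
    outside [K], moved back, and replaced once more by an orbit point close enough to stay off the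
    closed set. *)
Lemma thin_translate g : preserves_XN g -> thin (fun x => K (phi g x)).
Proof.
  intros [H1 H2]. split.
  - exact (open_translate mul inv nrm dX phi Hcont g _ HKclosed).
  - intros k eps He.
    destruct (proj1 Hcont (inv g) (phi g (f (u k))) (eps / 2)) as [delta [Hdl Hnear]]; [lra|].
    destruct (H1 _ (XN_orbit k) (delta / 2)) as [y [[i ->] Hy]]; [lra|].
    destruct (rad_small (delta / 2)) as [m Hm]; [lra|].
    destruct Hu as [_ [_ [_ [Hout _]]]]. destruct (Hout i m) as [i' [Hi'1 Hi'2]].
    set (w := f (u i')) in *.
    assert (Hw : dX (f (u k)) (phi (inv g) w) < eps / 2).
    { rewrite <- (act_invK mul inv e phi Hgrp Hact g (f (u k))). apply Hnear.
      pose proof (dist_tri dX HX (phi g (f (u k))) (f (u i)) w). lra. }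
    assert (HKw : ~ K (phi g (phi (inv g) w))).
    { rewrite (act_Kinv mul inv e phi Hgrp Hact). auto. }
    destruct (open_translate mul inv nrm dX phi Hcont g _ HKclosed _ HKw) as [eta [Heta Hfar]].
    destruct (H2 w (XN_orbit i') (Rmin eta (eps / 2))) as [y [[k' ->] Hk']].
    { apply Rmin_glb_lt; lra. }
    pose proof (Rmin_l eta (eps / 2)). pose proof (Rmin_r eta (eps / 2)).
    exists k'. split; [|apply Hfar; lra].
    pose proof (dist_tri dX HX (f (u k)) (phi (inv g) w) (f (u k'))). lra.
Qed.

(** No orbit point is isolated in the orbit: [K] contains [x0], so its translate by [u k] is a thin
    set containing [f (u k)], avoided by orbit points arbitrarily near. *)
Lemma thin_subsingleton (F : X -> Prop) : (forall x y, F x -> F y -> x = y) -> thin F.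
Proof.
  intros HF. split.
  - intros x Hx. destruct (classic (exists z, F z)) as [[z Hz]|Hno].
    + exists (dX x z). split; [apply dist_pos; auto; congruence|].
      intros y Hy HFy. rewrite (HF y z HFy Hz) in Hy. lra.
    + exists 1. split; [lra|]. eauto.
  - intros k eps He. destruct (classic (F (f (u k)))) as [HFk|HFk].
    2:{ exists k. rewrite dist_refl; auto. }
    destruct (proj2 (thin_translate (inv (u k)) (preserves_XN_inv _ (preserves_XN_orbit k)))
      k eps He) as [k' [H1 H2]].
    exists k'; split; auto. intros HFk'. apply H2. rewrite (HF _ _ HFk' HFk).
    unfold f. rewrite (act_invK mul inv e phi Hgrp Hact).
    rewrite <- (act_e mul e phi Hact x0). apply HK. rewrite (nrm_e mul inv e nrm Hnrm). auto.
Qed.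

Lemma XN_uncountable S : countable S -> exists w, XN w /\ ~ S w.
Proof.
  intros [v [Hv1 Hv2]].
  destruct (generic_unit (fun _ _ => True) v) as [xi [[Hxi _] Havoid]]; auto.
  - intros n g _. exists 1. split; [lra|auto].
  - intros n. apply thin_subsingleton. apply Hv1.
  - exists (f xi). split; [apply Hxi, XN_base|]. intros HS.
    destruct (Hv2 _ HS) as [n Hn]. exact (proj2 (Havoid n) Hn).
Qed.

Lemma countable_trace_XN (B : family X) : sigma_discrete dX B ->
  countable (fun b => B b /\ exists y, b y /\ XN y).
Proof. intros HB. apply (countable_trace dX HX B (fun k => f (u k)) XN HB). auto. Qed.

(** * Counting the cells of [G] whose images reach the separable set [XN] *)

Definition poor (delta : R) (w : X) : Prop :=
  countable (fun v => XN v /\ small_orbit mul inv e nrm phi delta w v).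

(** Countably many members of a base for the images of the poor parts of cells meet [XN]. A member
    containing the poor point [w] lies in the image of a cell of diameter less than [delta], hence
    in the [delta]-orbit of [w], so its trace on [XN] is countable. *)
Lemma countable_poor delta : 0 < delta -> countable (fun w => XN w /\ poor delta w).
Proof.
  intros Hdl. destruct (stone_cover d Hd (delta / 2)) as [E [HE1 [HE2 HE3]]]; [lra|].
  apply (countable_sub _ (fun w => exists n,
    XN w /\ poor delta w /\ exists c a, E n c a /\ f a = w)).
  2:{ intros w [H1 H2]. destruct (Htrans x0 w) as [a Ha]. destruct (HE1 a) as [n [c Hc]]. eauto 8. }
  apply countable_iUnion. intros n.
  destruct (cells_base d dX Hd f (Hbsd x0) (rad n)
    (fun c a => E n c a /\ poor delta (f a)) (rad_pos n)) as [B [HB Hbase]].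
  { intros c c' y y' [H _] [H' _]. apply HE3; auto. }
  apply (countable_bind
    (fun b => (B b /\ exists y, b y /\ XN y) /\ countable (fun v => b v /\ XN v)) _ (fun b v => b v /\ XN v)).
  - apply (countable_sub _ _ (countable_trace_XN B HB)). tauto.
  - tauto.
  - intros w [Hw1 [Hw2 [c [a [Ha <-]]]]].
    destruct (Hbase c (f a)) as [b [Hb1 [Hb2 Hb3]]]; [exists a; auto|].
    exists b; repeat split; eauto. apply (countable_sub _ _ Hw2). intros v [Hv1 Hv2].
    split; auto. destruct (Hb3 v Hv1) as [a' [[Ha' _] <-]].
    exists (mul a' (inv a)). split.
    + unfold ball. rewrite (dR_e mul inv e nrm Hgrp Hnrm).
      change (d a' a < delta). pose proof (HE2 _ _ _ Ha). pose proof (HE2 _ _ _ Ha').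
      pose proof (dist_tri d Hd a' c a). rewrite (dist_sym d Hd a' c) in *. lra.
    + unfold f. rewrite (act_mul mul e phi Hact), (act_invK mul inv e phi Hgrp Hact). auto.
Qed.

(* Otherwise shifting one point of each cell would turn uncountably many points of the
   separable space [XN] into the images of a discrete family of singletons. *)
Lemma countable_fiber_cells n (E : G -> G -> Prop) x w :
  separated d (rad n) E -> ~ poor (rad n / 4) w ->
  countable (fun c => exists g, E c g /\ phi g x = w).
Proof.
  intros HE Hw. apply NNPP. intros Hunc.
  destruct (uncountable_matching _ _ Hunc Hw) as [m [Hm Hm']]. apply Hm'.
  destruct (choice (fun c g => (exists g, E c g /\ phi g x = w) -> E c g /\ phi g x = w)) as [g Hg].
  { intros c. destruct (classic (exists g, E c g /\ phi g x = w)) as [[g Hg]|H]; [eauto|].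
    exists e; tauto. }
  destruct (choice (fun c b => nrm b < rad n / 4 /\ phi b w = m c)) as [b Hb].
  { intros c. destruct (Hm c) as [_ [b [Hb <-]]]. unfold ball in Hb.
    rewrite (dR_e mul inv e nrm Hgrp Hnrm) in Hb. eauto. }
  pose proof (rad_pos n) as Hrad.
  (* Shifts shorter than [rad n / 4] leave the singletons [mul (b c) (g c)] separated by
     [rad n / 2]. *)
  destruct (cells_base d dX Hd (fun g => phi g x) (Hbsd x) (rad n / 2)
    (fun c a => (exists g, E c g /\ phi g x = w) /\ a = mul (b c) (g c))) as [B [HB Hbase]].
  { lra. }
  { intros c c' y y' [Hc ->] [Hc' ->] Hne.
    pose proof (HE _ _ _ _ (proj1 (Hg c Hc)) (proj1 (Hg c' Hc')) Hne).
    pose proof (dist_tri d Hd (g c) (mul (b c) (g c)) (g c')).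
    pose proof (dist_tri d Hd (mul (b c) (g c)) (mul (b c') (g c')) (g c')).
    rewrite (dist_sym d Hd (mul (b c') (g c')) (g c')) in *.
    rewrite !(dR_mull mul inv e nrm Hgrp Hnrm) in *.
    pose proof (proj1 (Hb c)). pose proof (proj1 (Hb c')). lra. }
  (* A non-empty base member inside the image of a singleton is that one point, so the countable
     trace on [XN] enumerates the values [m c]. *)
  apply (countable_bind _ _ (fun b y => b y /\ forall z, b z -> z = y) (countable_trace_XN B HB)).
  - intros b' _. apply countable_single. intros y z [H1 H2] [H3 H4]; auto.
  - intros y [c [Hc <-]].
    assert (Himg : phi (mul (b c) (g c)) x = m c).
    { rewrite (act_mul mul e phi Hact), (proj2 (Hg c Hc)). apply Hb. }
    destruct (Hbase c (m c)) as [b' [Hb'1 [Hb'2 Hb'3]]]; [exists (mul (b c) (g c)); auto|].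
    exists b'. repeat split; auto.
    + exists (m c). split; auto. apply Hm.
    + intros z Hz. destruct (Hb'3 z Hz) as [a [[_ ->] <-]]. auto.
Qed.

(** Each cell receives a base member inside its image that meets [XN]. A point [y] of such a member
    lies in the images of all cells receiving it, and the fibre over a non-poor [y] meets only
    countably many cells. *)
Lemma countable_cells n (E : G -> G -> Prop) x : separated d (rad n) E ->
  countable (fun c => exists g, E c g /\ XN (phi g x) /\ ~ poor (rad n / 4) (phi g x)).
Proof.
  intros HE.
  destruct (cells_base d dX Hd (fun g => phi g x) (Hbsd x) (rad n)
    (fun c a => E c a /\ ~ poor (rad n / 4) (phi a x)) (rad_pos n)) as [B [HB Hbase]].
  { intros c c' y y' [H _] [H' _]. apply HE; auto. }
  apply (countable_bind _ _ (fun b c => forall z, b z -> exists a,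
    (E c a /\ ~ poor (rad n / 4) (phi a x)) /\ phi a x = z) (countable_trace_XN B HB)).
  - intros b [_ [y [Hy _]]].
    destruct (classic (poor (rad n / 4) y)) as [Hp|Hp].
    + apply countable_single. intros c c' Hc. exfalso.
      destruct (Hc y Hy) as [a [[_ Ha] E']]. apply Ha. rewrite E'; auto.
    + apply (countable_sub _ _ (countable_fiber_cells n E x y HE Hp)).
      intros c Hc. destruct (Hc y Hy) as [a [[Ha _] E']]. eauto.
  - intros c [g [Hg1 [Hg2 Hg3]]].
    destruct (Hbase c (phi g x)) as [b [Hb1 [Hb2 Hb3]]]; [exists g; auto|].
    exists b. repeat split; eauto.
Qed.

Lemma small_orbit_contradiction : False.
Proof.
  destruct (stone_cover d Hd (r / 2)) as [E [HE1 [HE2 HE3]]]; [lra|].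
  pose (Z z := exists n, XN z /\ poor (rad n / 4) z).
  assert (HZ : countable Z).
  { apply countable_iUnion. intros n. apply countable_poor. pose proof (rad_pos n); lra. }
  (* [x1] lies outside all [u k Z], so that a generic [xi] satisfies [inv xi x1 \notin Z]. *)
  destruct (XN_uncountable (fun w => exists k, exists z, Z z /\ phi (u k) z = w))
    as [x1 [Hx1 Hx1Z]].
  { apply countable_iUnion. intros k. apply countable_image; auto. }
  (* One representative is fixed in each cell containing an [XN]-preserving element that sends [x1]
     to a non-poor point; only countably many cells qualify. *)
  pose (H n c g := E n c g /\ preserves_XN g /\ ~ poor (rad n / 4) (phi g x1)).
  destruct (choice (fun (nc : nat * G) m =>
    (exists g, H (fst nc) (snd nc) g) -> H (fst nc) (snd nc) m)) as [M HM].
  { intros nc. destruct (classic (exists g, H (fst nc) (snd nc) g)) as [[g Hg]|Hno]; [eauto|].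
    exists e; tauto. }
  assert (HMc : countable (fun m => exists n, exists c, (exists g, H n c g) /\ M (n, c) = m)).
  { apply countable_iUnion. intros n. apply (countable_image _ (fun c => M (n, c))).
    apply (countable_sub _ _ (countable_cells n (E n) x1 (HE3 n))).
    intros c [g [H1 [H2 H3]]]. exists g. repeat split; auto. apply H2; auto. }
  destruct HMc as [vM [HvM1 HvM2]]. destruct HZ as [vZ [HvZ1 HvZ2]].
  (* As [vZ j] and [vM j] are subsingletons, each index forbids one value [z] and one set
     [K (phi m x)]: an open condition and a thin set. *)
  destruct (generic_unit (fun j g => forall z, vZ j z -> Z z -> phi g z <> x1)
    (fun j x => exists m, vM j m /\ preserves_XN m /\ K (phi m x))) as [xi [Hxi Hgen]].
  - intros j g Hg. destruct (classic (exists z, vZ j z /\ Z z)) as [[z [Hz1 Hz2]]|Hno].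
    + pose proof (dist_pos dX HX _ _ (Hg z Hz1 Hz2)) as Hpos.
      destruct (proj2 Hcont z g _ Hpos) as [delta [Hdl Hnear]].
      exists delta; split; auto. intros h Hh z' Hz' _ E'.
      rewrite (HvZ1 _ _ _ Hz' Hz1) in E'. pose proof (Hnear h Hh) as Hlt.
      simpl in Hlt. rewrite E' in Hlt. lra.
    + exists 1. split; [lra|]. intros h _ z Hz1 Hz2. exfalso; eauto.
  - intros j k z _ Hz E'. apply Hx1Z. eauto.
  - intros j. destruct (classic (exists m, vM j m /\ preserves_XN m)) as [[m [Hm1 Hm2]]|Hno].
    + rewrite (set_ext _ (fun x => K (phi m x))); [apply thin_translate; auto|].
      intros x; split; [|eauto]. intros [m' [Hm' [_ HKm]]].
      rewrite (HvM1 _ _ _ Hm1 Hm'); auto.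
    + apply thin_subsingleton. intros x y [m [Hm1 [Hm2 _]]]. exfalso; eauto.
  - set (w := phi (inv xi) x1).
    assert (Hw : XN w) by (apply Hxi; auto).
    assert (Hrich : forall n, ~ poor (rad n / 4) w).
    { intros n Hn. assert (HZw : Z w) by (exists n; auto).
      destruct (HvZ2 w HZw) as [j Hj]. apply (proj1 (Hgen j) w Hj HZw).
      apply (act_Kinv mul inv e phi Hgrp Hact). }
    destruct (HE1 (inv xi)) as [n [c Hc]].
    assert (Hex : exists g, H n c g).
    { exists (inv xi). split; auto. split; [apply preserves_XN_inv; auto|apply Hrich]. }
    destruct (HM (n, c) Hex) as [Hm1 [Hm2 _]]. simpl in Hm1. set (m := M (n, c)) in *.
    destruct (HvM2 m) as [j Hj]; [exists n, c; auto|].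
    apply (proj2 (Hgen j)). exists m. repeat split; auto; try apply Hm2.
    unfold f. rewrite <- (act_mul mul e phi Hact). apply HK.
    (* [d m (inv xi)] is the norm of [mul m xi], and [m] and [inv xi] share a cell of diameter less
       than [r]. *)
    rewrite <- (inv_inv mul inv e Hgrp xi). change (d m (inv xi) < r).
    pose proof (HE2 _ _ _ Hm1). pose proof (HE2 _ _ _ Hc).
    pose proof (dist_tri d Hd m c (inv xi)). rewrite (dist_sym d Hd m c) in *. lra.
Qed.

End SmallOrbits.

Theorem theoremE (G X : Type) (mul : G -> G -> G) (inv : G -> G) (e : G)
  (nrm : G -> R) (dX : X -> X -> R) (phi : G -> X -> X) :
  is_group mul inv e ->
  is_group_norm mul inv e nrm ->
  is_metric dX ->
  is_action mul e phi ->
  sep_continuous (dR mul inv nrm) dX phi ->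
  transitive_action phi ->
  baire_space (dR mul inv nrm) ->
  ~ meagre dX (fun _ => True) ->
  (nikodym_action (dR mul inv nrm) dX e phi ->
     conclusionE (dR mul inv nrm) dX e phi) /\
  (analytic (dR mul inv nrm) ->
   (forall x, base_sigma_discrete (dR mul inv nrm) dX (fun g => phi g x)) ->
     conclusionE (dR mul inv nrm) dX e phi).
Proof.
  intros Hgrp Hnrm HX Hact Hcont Htrans HG Hnm.
  split; [apply conclusion_of_nikodym; auto|]. intros Han Hbsd.
  destruct (analytic_souslin_scheme _ (dR_metric mul inv e nrm Hgrp Hnrm) Han) as [A HA].
  apply conclusion_of_nonmeagre with (A := A); auto.
  apply small_orbit_nonmeagre; auto.
  (* A failing [K] would contain the whole orbit of a ball, which [small_orbit_contradiction]
     refutes. *)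
  intros K HK1 HK2 r x Hr. apply NNPP. intros Hno.
  assert (HK : forall b, nrm b < r -> K (phi b x)).
  { intros b Hb. apply NNPP. intros H. eauto. }
  destruct (dense_witnesses_exist mul inv e nrm dX phi Hgrp Hnrm HX Htrans Hbsd A HA x K HK2 Hnm)
    as [u Hu].
  eapply small_orbit_contradiction; eauto.
Qed.
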